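(* Let $n\ge 2$, $r\ge1$, and let $k,q_1,\ldots,q_r,\epsilon_0,\ldots,\epsilon_{r-1}$ be integers. Then the cyclic presentation \[\mathcal{G}_n\big(x_1^{\epsilon_0}x_{1+q_1}^{\epsilon_1}\cdots x_{1+q_{r-1}}^{\epsilon_{r-1}}x_{1+q_r}\,(x_{1+k}^{\epsilon_0}x_{1+k+q_1}^{\epsilon_1}\cdots x_{1+k+q_{r-1}}^{\epsilon_{r-1}})^{-1}\big)\] is homotopy equivalent to the cyclic presentation \[\mathcal{G}_n\big((y_1^{-1}y_{1+k})^{\epsilon_0}(y_{1+q_1}^{-1}y_{1+q_1+k})^{\epsilon_1}\cdots(y_{1+q_{r-1}}^{-1}y_{1+q_{r-1}+k})^{\epsilon_{r-1}}\,y_{1+q_r}^{-1}\big).\] In particular, for $0\le p_0,\ldots,p_{r-1}\le n-1$ and $p_r=-1$, the presentation \[\mathcal{L}_n(p_0,\ldots,p_{r-1})=\mathcal{G}_n\big((x_{p_0}x_{p_1+1}\cdots x_{p_{r-1}+(r-1)}x_{p_r+r})(x_{p_0+1}x_{p_1+2}\cdots x_{p_{r-1}+r})^{-1}\big)\] is homotopy equivalent to \[\mathcal{G}_n\Big(\Big(\prod_{j=0}^{r-1}y_{j+1+(p_j-p_0)}^{-1}\,y_{j+2+(p_j-p_0)}\Big)\,y_{1+r+(p_r-p_0)}^{-1}\Big).\] All subscripts are taken mod $n$.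
   Context: For a word $w$ in the free group on $x_1,\ldots,x_n$, the cyclic presentation is $\mathcal{G}_n(w)=\langle x_1,\ldots,x_n\mid w,\theta(w),\ldots,\theta^{n-1}(w)\rangle$, where $\theta(x_i)=x_{i+1}$ (subscripts mod $n$); similarly for words in $y_1,\ldots,y_n$. Homotopy equivalence of presentations means homotopy equivalence of their standard 2-complexes (one 0-cell, one 1-cell per generator, one 2-cell per relator); in particular homotopy equivalent presentations define isomorphic groups. *)

(* Defs.v *)
From HB Require Import structures.
From mathcomp Require Import all_boot all_order all_algebra.
From mathcomp Require Import all_classical all_reals all_analysis.
From Stdlib Require Import Relation_Operators.
From mathcomp Require Import generic_quotient.
Set Implicit Arguments. Unset Strict Implicit. Unset Printing Implicit Defensive.
Import Order.TTheory GRing.Theory Num.Theory.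
Import numFieldNormedType.Exports.
Local Open Scope classical_set_scope.
Local Open Scope ring_scope.
Local Open Scope quotient_scope.

(* letters: (subscript a : int, inverted? : bool); subscripts read mod n *)
Definition letter := (int * bool)%type.
Definition word := seq letter.

Definition winv (w : word) : word := rev [seq (l.1, ~~ l.2) | l <- w].
Definition wpow (w : word) (e : int) : word :=
  if (0 <= e)%R then flatten (nseq `|e|%N w) else flatten (nseq `|e|%N (winv w)).
Definition gen (a : int) : word := [:: (a, false)].
Definition wshift (j : int) (w : word) : word := [seq (l.1 + j, l.2) | l <- w].

Definition cyclic_rels (n : nat) (w : word) : seq word :=
  [seq wshift j%:Z w | j <- iota 0 n].

Section Complex.
Variable R : realType.
Variables (n : nat) (rels : seq word).

Definition cell_pt (x : nat * (R * R)) : Prop :=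
  if x.1 == 0%N then x.2 = (0, 0)
  else if (x.1 <= n)%N then x.2.2 = 0 /\ 0 <= x.2.1 <= 1
  else if (x.1 <= n + size rels)%N then is_true (x.2.1 ^+ 2 + x.2.2 ^+ 2 <= 1)
  else False.

Local Notation cells := (set_type cell_pt).

Definition edge_index (a : int) : nat := (absz ((a - 1) %% n)%Z).+1.

Inductive glue : nat * (R * R) -> nat * (R * R) -> Prop :=
| glue_edge0 (i : nat) : (0 < i <= n)%N -> glue (i, (0, 0)) (0%N, (0, 0))
| glue_edge1 (i : nat) : (0 < i <= n)%N -> glue (i, (1, 0)) (0%N, (0, 0))
| glue_empty (j : nat) (th : R) : (j < size rels)%N ->
    nth [::] rels j = [::] ->
    glue ((n + j).+1, (cos (2 * trigo.pi * th), sin (2 * trigo.pi * th))) (0%N, (0, 0))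
| glue_seg (j t : nat) (u : R) : (j < size rels)%N ->
    (t < size (nth [::] rels j))%N -> 0 <= u -> u < 1 ->
    let L := size (nth [::] rels j) in
    let l := nth (0, false) (nth [::] rels j) t in
    let th := (t%:R + u) / L%:R in
    glue ((n + j).+1, (cos (2 * trigo.pi * th), sin (2 * trigo.pi * th)))
         (edge_index l.1, (if l.2 then 1 - u else u, 0)).

Definition cglue (x y : cells) : Prop :=
  clos_refl_sym_trans _ glue (set_val x) (set_val y).

Definition cglue_b (x y : cells) : bool := `[< cglue x y >].

Lemma cglue_refl : reflexive cglue_b.
Proof. by move=> x; apply/asboolP; apply: rst_refl. Qed.
Lemma cglue_sym : symmetric cglue_b.
Proof.
move=> x y; apply/asboolP/asboolP => h; exact: rst_sym.
Qed.
Lemma cglue_trans : transitive cglue_b.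
Proof.
move=> y x z /asboolP h1 /asboolP h2; apply/asboolP; exact: rst_trans h1 h2.
Qed.

Definition cglue_rel := EquivRel cglue_b cglue_refl cglue_sym cglue_trans.

Definition complex2 := {eq_quot cglue_rel}.
HB.instance Definition _ := Topological.copy complex2 (quotient_topology complex2).
End Complex.

Definition homotopic (X Y : topologicalType) (R : realType) (f g : X -> Y) :=
  exists H : (X * R)%type -> Y,
    {within [set p : (X * R)%type | 0 <= p.2 <= 1], continuous H} /\
    (forall x, H (x, 0) = f x) /\ (forall x, H (x, 1) = g x).

Definition homotopy_equivalent (R : realType) (X Y : topologicalType) :=
  exists (f : X -> Y) (g : Y -> X), continuous f /\ continuous g /\
    homotopic R (g \o f) idfun /\ homotopic R (f \o g) idfun.

Definition cyclic_complex (R : realType) (n : nat) (w : word) :=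
  complex2 R n (cyclic_rels n w).

Definition q0 (q : nat -> int) (j : nat) : int := if j == 0%N then 0 else q j.

Definition word_x (r : nat) (k : int) (q eps : nat -> int) : word :=
  flatten [seq wpow (gen (1 + q0 q j)) (eps j) | j <- iota 0 r]
  ++ gen (1 + q r)
  ++ winv (flatten [seq wpow (gen (1 + k + q0 q j)) (eps j) | j <- iota 0 r]).

Definition word_y (r : nat) (k : int) (q eps : nat -> int) : word :=
  flatten [seq wpow (winv (gen (1 + q0 q j)) ++ gen (1 + q0 q j + k)) (eps j)
          | j <- iota 0 r]
  ++ winv (gen (1 + q r)).

Definition pr (r : nat) (p : nat -> int) (j : nat) : int :=
  if j == r then -1 else p j.

Definition word_L (r : nat) (p : nat -> int) : word :=
  [seq (pr r p j + j%:Z, false) | j <- iota 0 r.+1]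
  ++ winv [seq (p j + j%:Z + 1, false) | j <- iota 0 r].

Definition word_Ly (r : nat) (p : nat -> int) : word :=
  flatten [seq winv (gen (j%:Z + 1 + (p j - p 0%N))) ++ gen (j%:Z + 2 + (p j - p 0%N))
          | j <- iota 0 r]
  ++ winv (gen (1 + r%:Z + (pr r p r - p 0%N))).

(* Main.v *)
Require Import Defs.
From HB Require Import structures.
From mathcomp Require Import all_boot all_order all_algebra.
From mathcomp Require Import all_classical all_reals all_analysis.
From Stdlib Require Import Relation_Operators.
From mathcomp Require Import generic_quotient.
From mathcomp Require Import ring lra zify.
Set Implicit Arguments. Unset Strict Implicit. Unset Printing Implicit Defensive.
Import Order.TTheory GRing.Theory Num.Theory.
Import numFieldNormedType.Exports.
Local Open Scope classical_set_scope.
Local Open Scope ring_scope.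

(* Let A_i = x_i^e_0 x_{i+q_1}^e_1 ... x_{i+q_{r-1}}^e_{r-1}.  Let g map the wedge of
   the circles x_m to that of the circles y_m by x_m |-> y_m^-1 y_{m+k}, and let f
   map it back by y_m |-> A_{m-q_r}.  Up to a cyclic rotation the relators of the first
   presentation say x_m = (f o g)(x_m) and those of the second (up to inversion)
   y_m = (g o f)(y_m), so the two complexes are the pointed mapping tori of f o g
   and of g o f.  These are homotopy equivalent: [x, t] |-> [g x, t] and
   [y, t] |-> [f y, t] are well defined, and both composites, such as
   [x, t] |-> [f (g x), t], are homotopic to the identity by flowing once around
   the torus.  Each disk of a complex is seen as a square with its vertical sides
   collapsed, whose bottom is the arc of the boundary circle reading the letter x_m
   and whose top is the complementary arc. *)

(** * Continuous maps and clamping *)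

(** Why the relators have the stated form: with m = i + q_r, the relator A_i x_m A_{i+k}^-1 says x_m
    = A_i^-1 A_{i+k}, and A_i = f(y_m), A_{i+k} = f(y_{m+k}), so the right side is f(y_m^-1 y_{m+k})
    = f(g(x_m)). The second relator is g(A_i) y_m^-1 with A_i = f(y_m), that is y_m = g(f(y_m)). The
    tori are pointed because a presentation complex has a single vertex. Two obstacles shape the
    formalization. The disks are round and their boundaries are read at constant speed, so each
    square needs an explicit chart with prescribed boundary values. This chart must still work when
    all exponents vanish: the relator is then one letter, and the complementary arc is a single
    point. The complex is moreover a bare topological quotient, so it is handled only through its
    points and the continuous maps out of it. The wedge of circles is never built as a space: its
    points are representatives in [int * R], and words are never freely reduced. *)

Lemma paste_continuous (R : realType) (X Y : topologicalType)
    (h : X -> R) (c : R) (f g : X -> Y) :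
  continuous h -> continuous f -> continuous g ->
  (forall x, h x = c -> f x = g x) ->
  continuous (fun x => if h x <= c then f x else g x).
Proof.
move=> hc fc gc fg; apply/continuous_closedP => C cC.
have -> : (fun x => if h x <= c then f x else g x) @^-1` C =
    ((f @^-1` C) `&` (h @^-1` [set y | y <= c])) `|`
    ((g @^-1` C) `&` (h @^-1` [set y | c <= y])).
  apply/seteqP; split=> x /=.
    by case: leP => [le_hc|/ltW le_ch]; [left|right].
  case=> -[Cx le_hx]; first by rewrite le_hx.
  case: leP => // le_xh; rewrite fg //; apply/eqP; rewrite eq_le le_xh; exact: le_hx.
have cp (k : X -> Y) : continuous k -> closed (k @^-1` C).
  by move=> /continuous_closedP; apply.
have cl (A : set R) : closed A -> closed (h @^-1` A).
  by move/continuous_closedP: hc; apply.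
apply: closedU; apply: closedI; try exact: cp.
- by apply: cl; exact: closed_le.
- by apply: cl; exact: closed_ge.
Qed.

(** Extends maps from the unit interval or square to the whole line or plane, so that most
    continuity statements avoid subspace topologies. *)
Definition clamp (R : realType) (x : R) : R := Num.max 0 (Num.min 1 x).

Lemma clamp_itv (R : realType) (x : R) : 0 <= clamp x <= 1.
Proof. by rewrite /clamp le_max lexx /= ge_max ler01 ge_min lexx. Qed.

Lemma clamp_id (R : realType) (x : R) : 0 <= x <= 1 -> clamp x = x.
Proof. by case/andP=> x0 x1; rewrite /clamp (min_idPr x1) (max_idPr x0). Qed.

Lemma clamp_le0 (R : realType) (x : R) : x <= 0 -> clamp x = 0.
Proof.
by move=> x0; rewrite /clamp (min_idPr (le_trans x0 ler01)) (max_idPl x0).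
Qed.

Lemma clamp_ge1 (R : realType) (x : R) : 1 <= x -> clamp x = 1.
Proof. by move=> x1; rewrite /clamp (min_idPl x1) (max_idPr ler01). Qed.

Lemma continuous_clamp (R : realType) : continuous (@clamp R).
Proof.
move=> x; apply: continuous_max; first exact: cst_continuous.
by apply: continuous_min; [exact: cst_continuous|exact: cvg_id].
Qed.

Lemma pair_continuous (X Y Z : topologicalType) (f : X -> Y) (g : X -> Z) :
  continuous f -> continuous g -> continuous (fun x => (f x, g x)).
Proof. by move=> fc gc x; apply: cvg_pair; [exact: fc|exact: gc]. Qed.

Lemma fst_continuous (X Y : topologicalType) : continuous (@fst X Y).
Proof. by move=> x; exact: cvg_fst. Qed.

Lemma snd_continuous (X Y : topologicalType) : continuous (@snd X Y).
Proof. by move=> x; exact: cvg_snd. Qed.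

Lemma comp_continuous (X Y Z : topologicalType) (f : X -> Y) (g : Y -> Z) :
  continuous f -> continuous g -> continuous (g \o f).
Proof. by move=> fc gc x; apply: continuous_comp; [exact: fc|exact: gc]. Qed.

Lemma addr_continuous (R : realType) (X : topologicalType) (f g : X -> R) :
  continuous f -> continuous g -> continuous (fun x => f x + g x).
Proof. by move=> fc gc x; apply: cvgD; [exact: fc|exact: gc]. Qed.

Lemma mulr_continuous (R : realType) (X : topologicalType) (f g : X -> R) :
  continuous f -> continuous g -> continuous (fun x => f x * g x).
Proof. by move=> fc gc x; apply: cvgM; [exact: fc|exact: gc]. Qed.

Lemma oppr_continuous (R : realType) (X : topologicalType) (f : X -> R) :
  continuous f -> continuous (fun x => - f x).
Proof. by move=> fc x; apply: cvgN; exact: fc. Qed.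

(** * Mapping tori *)

Section Torus.
Variables (R : realType) (n : nat).

(* A point of the wedge of the circles x_a (a mod n) is a pair (a, u) with u in [0, 1],
   all pairs with u = 0 or u = 1 being the base point.  A family E as below is a map
   from (wedge) x [0, 1] that does not depend on the second coordinate at the base
   point; (u, t) is the point at height t over (a, u). *)
Record cylinders (W : topologicalType) (E : int -> R * R -> W) : Prop := {
  cyl_continuous : forall a, continuous (E a);
  cyl_side : forall a b (u v t t' : R), u = 0 \/ u = 1 -> v = 0 \/ v = 1 ->
    E a (u, t) = E b (v, t');
  cyl_mod : forall a b, (a = b %[mod n%:Z])%Z -> E a = E b }.

Arguments cyl_continuous {W E} _ a.

Definition glued_by (f : int * R -> int * R) (W : topologicalType)
    (E : int -> R * R -> W) :=
  forall a (u : R), 0 <= u <= 1 ->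
    E a (u, 1) = E (f (a, u)).1 ((f (a, u)).2, 0).

(** The pointed mapping torus, given by its universal property: [torus_lift] produces the maps out
    of it, and [torus_cover] makes their values determined. *)
Record mapping_torus (f : int * R -> int * R) (K : topologicalType)
    (Q : int -> R * R -> K) : Prop := {
  torus_cyl : cylinders Q;
  torus_glued : glued_by f Q;
  torus_cover : forall x, exists a u t,
    [/\ 0 <= u <= 1, 0 <= t <= 1 & x = Q a (u, t)];
  torus_lift : forall (W : topologicalType) (E : int -> R * R -> W),
    cylinders E -> glued_by f E ->
    exists2 F : K -> W, continuous F &
      forall a u t, 0 <= u <= 1 -> 0 <= t <= 1 -> F (Q a (u, t)) = E a (u, t) }.

Definition pull (f : int * R -> int * R) (W : Type) (E : int -> R * R -> W)
    (a : int) (p : R * R) : W :=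
  E (f (a, p.1)).1 ((f (a, p.1)).2, p.2).

(** On [int * R] the ends of the circles are not identified, so plain continuity of [f] would be the
    wrong condition. Continuity on the wedge is tested instead against every family of cylinders. *)
Record graph_map (f : int * R -> int * R) : Prop := {
  graph_map_itv : forall p, 0 <= p.2 <= 1 -> 0 <= (f p).2 <= 1;
  graph_map_pull : forall (W : topologicalType) (E : int -> R * R -> W),
    cylinders E -> cylinders (pull f E) }.

Lemma graph_map_comp f g : graph_map f -> graph_map g -> graph_map (f \o g).
Proof.
move=> [fI fE] [gI gE]; split=> [p pI|W E cE]; first exact/fI/gI.
have -> : pull (f \o g) E = pull g (pull f E).
  by apply/funext => a; apply/funext => p; rewrite /pull /= -surjective_pairing.
exact: (gE _ _ (fE _ _ cE)).
Qed.

Section Flow.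
Variables (f : int * R -> int * R) (K : topologicalType) (Q : int -> R * R -> K).
Hypotheses (fg : graph_map f) (KQ : mapping_torus f Q).

(* Heights above 1 are reached by crossing the top of the square over (a, u), which is
   the bottom over f (a, u). *)
Let flow (a : int) (p : (R * R) * R) : K :=
  if clamp p.1.2 + clamp p.2 <= 1
  then Q a (clamp p.1.1, clamp p.1.2 + clamp p.2)
  else pull f Q a (clamp p.1.1, clamp p.1.2 + clamp p.2 - 1).

Let flow_continuous a : continuous (flow a).
Proof.
have c1 : continuous (fun p : (R * R) * R => clamp p.1.1).
  apply: (comp_continuous _ (@continuous_clamp R)).
  exact: (comp_continuous (@fst_continuous _ _) (@fst_continuous _ _)).
have c2 : continuous (fun p : (R * R) * R => clamp p.1.2 + clamp p.2).
  apply: addr_continuous.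
    apply: (comp_continuous _ (@continuous_clamp R)).
    exact: (comp_continuous (@fst_continuous _ _) (@snd_continuous _ _)).
  exact: (comp_continuous (@snd_continuous _ _) (@continuous_clamp R)).
have c3 : continuous (fun p : (R * R) * R => clamp p.1.2 + clamp p.2 - 1).
  by apply: addr_continuous => // ?; exact: cst_continuous.
apply: (paste_continuous c2).
- exact: (comp_continuous (pair_continuous c1 c2) (cyl_continuous (torus_cyl KQ) a)).
- apply: (comp_continuous (pair_continuous c1 c3)).
  exact: (cyl_continuous (graph_map_pull fg (torus_cyl KQ)) a).
- move=> p ->; rewrite /pull /= subrr; apply: (torus_glued KQ); exact: clamp_itv.
Qed.

Let flow_top a u s : 0 <= u <= 1 -> flow a ((u, 1), s) = pull f Q a (u, clamp s).
Proof.
move=> uI; rewrite /flow /= (clamp_id uI) (clamp_id (x := 1)) ?ler01 ?lexx //.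
case: leP => [s0|_]; last by congr (pull _ _ _ (_, _)); ring.
have [s0' _] := andP (clamp_itv s).
have -> : clamp s = 0 by lra.
by rewrite addr0 (torus_glued KQ).
Qed.

Let flow_cyl :
  cylinders (fun a => curry (flow a) : R * R -> {compact-open, R -> K}).
Proof.
have fcyl := graph_map_pull fg (torus_cyl KQ).
split.
- by move=> a; exact: continuous_curry_fun (@flow_continuous a).
- have side a (u t s : R) : u = 0 \/ u = 1 -> flow a ((u, t), s) = Q 0 (0, 0).
    move=> u01; have uI : 0 <= u <= 1 by case: u01 => ->; rewrite lexx ler01.
    rewrite /flow /= (clamp_id uI).
    case: ifP => _; first by apply: (cyl_side (torus_cyl KQ)); auto.
    (* On a side the height can be reset to 0; there the point over f (a, u) is the top of the
       square over (a, u), hence on a side of [Q] again. *)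
    rewrite (cyl_side fcyl a a _ 0 u01 u01) /pull /=.
    rewrite -(torus_glued KQ) //; apply: (cyl_side (torus_cyl KQ)); auto.
  move=> a b u v t t' u01 v01; apply/funext => s.
  by rewrite /curry !side.
- move=> a b ab; apply/funext => p; apply/funext => s; rewrite /curry /flow.
  by rewrite (cyl_mod (torus_cyl KQ) ab) (cyl_mod fcyl ab).
Qed.

(** [f x, t] is the point at height t + 1 above x, so letting the excess height fall from 1 to 0
    deforms [G] into the identity. *)
Lemma torus_flow (G : K -> K) :
  (forall a u t, 0 <= u <= 1 -> 0 <= t <= 1 ->
     G (Q a (u, t)) = pull f Q a (u, t)) -> homotopic R G idfun.
Proof.
move=> GQ.
(* Lifting into a space of paths and uncurrying avoids having to know that the product
   of the quotient map with the interval is again a quotient map. *)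
have [|H Hc HQ] := torus_lift KQ flow_cyl.
  move=> a u uI; apply/funext => s; rewrite /curry flow_top //.
  have fI := graph_map_itv fg (p := (a, u)) uI.
  rewrite /flow /= (clamp_id fI) (clamp_le0 (lexx 0)) add0r.
  by case/andP: (clamp_itv s) => _ ->.
have Hc' x : continuous (H x : R -> K).
  have [a [u [t [uI tI ->]]]] := torus_cover KQ x; rewrite HQ // => s.
  apply: (comp_continuous _ (@flow_continuous a)).
  apply: pair_continuous => ?; [exact: cst_continuous|exact: cvg_id].
(* The flow starts at the identity while the homotopy must end there, so time is reversed. *)
have cH : continuous (uncurry (fun x s => H x (1 - s))).
  have -> : uncurry (fun x s => H x (1 - s)) =
      uncurry (fun x => H x : R -> K) \o (fun p : K * R => (p.1, 1 - p.2)).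
    by apply/funext => -[].
  apply: comp_continuous.
    apply: pair_continuous; first exact: fst_continuous.
    apply: addr_continuous; first by move=> ?; exact: cst_continuous.
    exact: oppr_continuous (@snd_continuous _ _).
  apply: continuous_uncurry => //; exact: locally_compactR.
exists (uncurry (fun x s => H x (1 - s))); split; first exact: continuous_subspaceT.
split=> x; have [a [u [t [uI tI ->]]]] := torus_cover KQ x.
  rewrite /= subr0 HQ // GQ // /curry /flow /= !clamp_id ?ler01 ?lexx // addrK.
  case: ifP => [t0|_ //]; have -> : t = 0 by case/andP: tI => *; lra.
  by rewrite add0r (torus_glued KQ).
rewrite /= subrr HQ // /curry /flow /= !clamp_id ?ler01 ?lexx // addr0.
by case/andP: tI => _ ->.
Qed.

End Flow.

(** The map [x, t] |-> [g x, t] respects the gluings because g o (f o g) = (g o f) o g. *)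
Lemma torus_map (f g : int * R -> int * R) (K L : topologicalType)
    (Q : int -> R * R -> K) (P : int -> R * R -> L) :
  graph_map f -> graph_map g ->
  mapping_torus (f \o g) Q -> mapping_torus (g \o f) P ->
  exists2 F : K -> L, continuous F &
    forall a u t, 0 <= u <= 1 -> 0 <= t <= 1 ->
      F (Q a (u, t)) = pull g P a (u, t).
Proof.
move=> fg gg KQ LP; apply: (torus_lift KQ).
  exact: (graph_map_pull gg (torus_cyl LP)).
move=> a u uI; rewrite /pull /=; have := graph_map_itv gg (p := (a, u)) uI.
by case: (g (a, u)) => b v /= vI; rewrite (torus_glued LP) //= -surjective_pairing.
Qed.

Lemma mapping_torus_comp_comm (f g : int * R -> int * R) (K L : topologicalType)
    (Q : int -> R * R -> K) (P : int -> R * R -> L) :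
  graph_map f -> graph_map g ->
  mapping_torus (f \o g) Q -> mapping_torus (g \o f) P ->
  homotopy_equivalent R K L.
Proof.
move=> fg gg KQ LP.
have [F Fc FQ] := torus_map fg gg KQ LP.
have [G Gc GP] := torus_map gg fg LP KQ.
exists F, G; split=> //; split=> //; split.
- apply: (torus_flow (graph_map_comp fg gg) KQ) => a u t uI tI.
  rewrite /= FQ // /pull /=; have := graph_map_itv gg (p := (a, u)) uI.
  by case: (g (a, u)) => b v /= vI; rewrite GP.
- apply: (torus_flow (graph_map_comp gg fg) LP) => a u t uI tI.
  rewrite /= GP // /pull /=; have := graph_map_itv fg (p := (a, u)) uI.
  by case: (f (a, u)) => b v /= vI; rewrite FQ.
Qed.

End Torus.

Arguments cyl_continuous {R n W E} _ a.

(** * Words as paths in a wedge of circles *)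

Definition endpoint (R : realType) (p : int * R) := p.2 = 0 \/ p.2 = 1.

(** Equality in the wedge of circles, for representatives; families of cylinders cannot tell such
    pairs apart ([same_point_cyl]). *)
Definition same_point (R : realType) (n : nat) (p q : int * R) :=
  (p.1 = q.1 %[mod n%:Z])%Z /\ p.2 = q.2 \/ endpoint p /\ endpoint q.

(* The point reached at time x when each letter of w takes unit time; (0, 0) stands for
   the base point once w is exhausted. *)
Fixpoint path_at (R : realType) (w : word) (x : R) : int * R :=
  if w is l :: w' then
    if 1 <= x then path_at w' (x - 1)
    else (l.1, if l.2 then 1 - clamp x else clamp x)
  else (0, 0).

Section PathAt.
Variables (R : realType) (n : nat).
Implicit Types (w : word) (x u : R) (p q : int * R).
Local Notation "p ~= q" := (same_point n p q) (at level 70).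

Lemma same_point_refl p : p ~= p.
Proof. by left. Qed.

Lemma same_point_sym p q : p ~= q -> q ~= p.
Proof. by rewrite /same_point => -[[-> ->]|[]]; [left|right]. Qed.

Lemma same_point_trans q p r : p ~= q -> q ~= r -> p ~= r.
Proof.
rewrite /same_point /endpoint.
case=> [[-> ->] //|[pe qe]] [[_ <-]|[_ re]]; by right.
Qed.

Lemma endpoint_same p q : endpoint p -> endpoint q -> p ~= q.
Proof. by right. Qed.

Lemma same_point_cyl (W : topologicalType) (E : int -> R * R -> W) p q t :
  cylinders n E -> p ~= q -> E p.1 (p.2, t) = E q.1 (q.2, t).
Proof.
move=> cE [[pq ->]|[pe qe]]; first by rewrite (cyl_mod cE pq).
exact: (cyl_side cE).
Qed.

Lemma path_at_itv w x : 0 <= (path_at w x).2 <= 1.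
Proof.
elim: w x => [|l w IH] x /=; first by rewrite lexx ler01.
case: ifP => _; first exact: IH.
by have := clamp_itv x; case: (l.2) => //= /andP[? ?]; lra.
Qed.

Lemma path_at_le0 w x : x <= 0 -> endpoint (path_at w x).
Proof.
case: w => [|l w] x0; first by left.
rewrite /= leNgt (le_lt_trans x0 ltr01) /= (clamp_le0 x0) /endpoint /=.
by case: (l.2); rewrite ?subr0; auto.
Qed.

Lemma path_at_ge w x : (size w)%:R <= x -> path_at w x = (0, 0).
Proof.
elim: w x => [//|l w IH] x /=; rewrite -natr1 => wx.
have -> : 1 <= x by have := ler0n R (size w); lra.
by apply: IH; lra.
Qed.

Lemma path_at_nth w (t : nat) u : (t < size w)%N -> 0 <= u < 1 ->
  let l := nth (0, false) w t in
  path_at w (t%:R + u) = (l.1, if l.2 then 1 - u else u).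
Proof.
move=> + /andP[u0 u1]; elim: w t => [//|l w IH] [|t] /= tw.
  by rewrite add0r leNgt u1 /= clamp_id // u0 ltW.
have -> : 1 <= t.+1%:R + u :> R by rewrite -natr1; have := ler0n R t; lra.
have -> : t.+1%:R + u - 1 = t%:R + u :> R by rewrite -natr1; ring.
exact: IH.
Qed.

Lemma path_at_cat w1 w2 x : 0 <= x ->
  path_at (w1 ++ w2) x =
  if (size w1)%:R <= x then path_at w2 (x - (size w1)%:R) else path_at w1 x.
Proof.
elim: w1 x => [|l w IH] x x0 /=; first by rewrite x0 subr0.
rewrite -natr1; case: ifP => x1.
  rewrite IH; last by lra.
  by rewrite lerBrDr; congr (if _ then path_at _ _ else _); ring.
case: (leP ((size w)%:R + 1)) => // wx; move: x1.
by have -> : 1 <= x by have := ler0n R (size w); lra.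
Qed.

Lemma winv_cons l w : winv (l :: w) = winv w ++ [:: (l.1, ~~ l.2)].
Proof. by rewrite /winv /= rev_cons -cats1. Qed.

Lemma size_winv w : size (winv w) = size w.
Proof. by rewrite size_rev size_map. Qed.

(** Inverting a word reverses time. Equality holds only in the wedge: at integer times the two sides
    may choose ends of different letters. *)
Lemma path_at_winv w x : path_at (winv w) x ~= path_at w ((size w)%:R - x).
Proof.
elim: w x => [|l w IH] x; first exact: same_point_refl.
case: (leP 0 x) => [x0|x0]; last first.
  apply: endpoint_same; first exact/path_at_le0/ltW.
  by rewrite path_at_ge; [left|lra].
rewrite winv_cons path_at_cat // size_winv [size _]/= -natr1.
case: ifP => [wx|/negbT]; last first.
  rewrite -ltNge => xw; rewrite [X in _ ~= X]/=.
  have -> : 1 <= (size w)%:R + 1 - x by lra.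
  by have -> : (size w)%:R + 1 - x - 1 = (size w)%:R - x by ring.
set y := x - _; have y0 : 0 <= y by rewrite /y; lra.
have -> : (size w)%:R + 1 - x = 1 - y by rewrite /y; ring.
rewrite /=; case: (leP 1 y) => y1.
  have -> : 1 <= 1 - y = false by lra.
  apply: endpoint_same; first by left.
  by rewrite clamp_le0 /endpoint /=; [case: (l.2); rewrite ?subr0; auto|lra].
case: (leP 1 (1 - y)) => y1'.
  have -> : y = 0 by lra.
  apply: endpoint_same; last by apply: path_at_le0; lra.
  by rewrite clamp_le0 // /endpoint /=; case: (l.2); rewrite ?subr0 /=; auto.
rewrite !clamp_id; [|lra..].
by left; split=> //=; case: (l.2) => /=; ring.
Qed.

Lemma path_at_wshift (s : int) w x : (n%:Z %| s)%Z ->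
  path_at (wshift s w) x ~= path_at w x.
Proof.
move=> ns; elim: w x => [|l w IH] x /=; first exact: same_point_refl.
case: ifP => // _; left; split=> //=.
by apply/eqP; rewrite eqz_mod_dvd addrC addKr.
Qed.

(** Where one letter gives way to the next, both pieces sit at the base point, and there [E] forgets
    the letter and the height. *)
Lemma path_at_continuous (W : topologicalType) (E : int -> R * R -> W) w :
  cylinders n E ->
  continuous (fun p : R * R => E (path_at w p.1).1 ((path_at w p.1).2, p.2)).
Proof.
move=> cE; elim: w => [|l w IH] /=.
  apply: (comp_continuous (f := fun p : R * R => (0, p.2)) _ (cyl_continuous cE 0)).
  by apply: pair_continuous => ?; [exact: cst_continuous|exact: snd_continuous].
have c1 : continuous (fun p : R * R => - p.1).
  exact: oppr_continuous (@fst_continuous _ _).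
pose hd (p : R * R) := E l.1 (if l.2 then 1 - clamp p.1 else clamp p.1, p.2).
pose tl (p : R * R) := E (path_at w (p.1 - 1)).1 ((path_at w (p.1 - 1)).2, p.2).
(* The sign change turns the test [1 <= x] of [path_at] into the shape that [paste_continuous]
   expects. *)
rewrite [X in continuous X](_ : _ = fun p : R * R => if - p.1 <= -1 then tl p else hd p);
  last by apply/funext => p; rewrite lerN2; case: ifP.
have cc : continuous (fun p : R * R => clamp p.1).
  exact: (comp_continuous (@fst_continuous _ _) (@continuous_clamp R)).
apply: (paste_continuous c1).
- apply: (comp_continuous (f := fun p : R * R => (p.1 - 1, p.2)) _ IH).
  apply: (pair_continuous _ (@snd_continuous _ _)).
  apply: (addr_continuous (@fst_continuous _ _)) => ?; exact: cst_continuous.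
- apply: (comp_continuous
    (f := fun p : R * R => (if l.2 then 1 - clamp p.1 else clamp p.1, p.2))
    _ (cyl_continuous cE l.1)).
  apply: (pair_continuous _ (@snd_continuous _ _)); case: (l.2) => //.
  apply: addr_continuous; first by move=> ?; exact: cst_continuous.
  exact: oppr_continuous.
- move=> p /oppr_inj p1; rewrite /tl /hd p1 subrr.
  apply: (cyl_side cE); first exact: path_at_le0.
  by rewrite clamp_id ?lexx ?ler01 //; case: (l.2); rewrite ?subrr; [left|right].
Qed.

(** The circle x_a runs through [W a] at constant speed; if [W a] is empty, it collapses to the base
    point. *)
Definition word_map (W : int -> word) (p : int * R) : int * R :=
  path_at (W p.1) ((size (W p.1))%:R * p.2).

Lemma word_map_graph_map (W : int -> word) :
  (forall a s, W (a + s) = wshift s (W a)) -> graph_map n (word_map W).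
Proof.
move=> Wshift; split=> [p _|V E cE]; first exact: path_at_itv.
have Wmod a b : (a = b %[mod n%:Z])%Z ->
    exists2 s, (n%:Z %| s)%Z & W a = wshift s (W b).
  move=> ab; exists (a - b); first by rewrite -eqz_mod_dvd; exact/eqP.
  by rewrite -Wshift subrKC.
have side a u : u = 0 \/ u = 1 -> endpoint (word_map W (a, u)).
  rewrite /word_map; case=> -> /=; first by apply: path_at_le0; rewrite mulr0.
  by rewrite mulr1 path_at_ge //; left.
split.
- move=> a; rewrite /pull /word_map /=.
  apply: (comp_continuous (f := fun p : R * R => ((size (W a))%:R * p.1, p.2))
    _ (path_at_continuous (w := W a) cE)).
  apply: (pair_continuous _ (@snd_continuous _ _)).
  by apply: (mulr_continuous _ (@fst_continuous _ _)) => ?; exact: cst_continuous.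
- by move=> a b u v t t' /(side a) u01 /(side b) v01; exact: (cyl_side cE).
- move=> a b /Wmod[s ns ab]; apply/funext => p; apply: (same_point_cyl _ cE).
  by rewrite /word_map /= ab size_map; exact: path_at_wshift.
Qed.

End PathAt.

(** * Squares covering the disk *)

Section Bigon.
Variable R : realType.
Implicit Types (x y s t u a b k d : R) (p z : R * R).
Local Notation pi := (@trigo.pi R).

Definition turn (th : R) : R * R := (cos (2 * pi * th), sin (2 * pi * th)).

Definition sqnorm (z : R * R) : R := z.1 ^+ 2 + z.2 ^+ 2.

Definition rotation (a : R) (z : R * R) : R * R :=
  (z.1 * cos a - z.2 * sin a, z.1 * sin a + z.2 * cos a).

Lemma rotD a b z : rotation (a + b) z = rotation a (rotation b z).
Proof. by rewrite /rotation cosD sinD /=; congr (_, _); ring. Qed.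

Lemma rot0 z : rotation 0 z = z.
Proof. by case: z => x y; rewrite /rotation cos0 sin0 /=; congr (_, _); ring. Qed.

Lemma rotNK a z : rotation a (rotation (- a) z) = z.
Proof. by rewrite -rotD subrr rot0. Qed.

Lemma rotKN a z : rotation (- a) (rotation a z) = z.
Proof. by rewrite -rotD addNr rot0. Qed.

Lemma sqnorm_rot a z : sqnorm (rotation a z) = sqnorm z.
Proof.
have <- : sqnorm z * (cos a ^+ 2 + sin a ^+ 2) = sqnorm z.
  by rewrite cos2Dsin2 mulr1.
by rewrite /sqnorm /rotation /=; ring.
Qed.

Definition lens (s t : R) : R * R := (t * cos (pi / 2 * s), - sin (pi / 2 * s)).

(* The chord joining the two points at parameter s of complementary arcs of the
   circle is the horizontal chord at height - sin (pi s / 2) turned by k s, where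
   k measures how far the arcs are from being half circles. *)
Definition chord (k d s t : R) : R * R := rotation (k * s + d) (lens s t).

Lemma sqnorm_lens s t : sqnorm (lens s t) = 1 - (1 - t ^+ 2) * cos (pi / 2 * s) ^+ 2.
Proof. by rewrite /sqnorm /= sqrrN (sin2cos2 (pi / 2 * s)); ring. Qed.

(** sin y - sin x = 2 cos((x+y)/2) sin((y-x)/2), and both factors are positive. The angles may leave
    the interval on which sine increases. *)
Lemma sin_lt x y : x < y -> y - x < 2 * pi -> - pi < x + y -> x + y < pi ->
  sin x < sin y.
Proof.
move=> xy yx nxy xyp; rewrite -subr_gt0.
pose m := (x + y) / 2; pose h := (y - x) / 2.
have mI : 0 < cos m.
  by apply: cos_gt0_pihalf; rewrite /m; lra.
have hI : 0 < sin h.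
  by apply: sin_gt0_pi; rewrite /h; lra.
have -> : sin y = sin (m + h) by congr sin; rewrite /m /h; field.
have -> : sin x = sin (m - h) by congr sin; rewrite /m /h; field.
rewrite sinD sinB.
have -> : sin m * cos h + cos m * sin h - (sin m * cos h - cos m * sin h) =
  2 * (cos m * sin h) by ring.
by rewrite mulr_gt0 // mulr_gt0.
Qed.

Lemma cos_pihalfM_gt0 s : -1 < s < 1 -> 0 < cos (pi / 2 * s).
Proof.
have pi0 : 0 < pi by exact: pi_gt0.
by move=> /andP[s1 s2]; apply: cos_gt0_pihalf; apply/andP; split; nra.
Qed.

(** The ends of chord s have angles (k + pi/2) s + d + pi and (k - pi/2) s + d. The bound on [k]
    makes them move weakly in opposite directions along the circle, so chords do not cross inside
    the disk. *)
Lemma chord_inj k d s t s' t' : `|k| <= pi / 2 ->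
  -1 < s < 1 -> -1 < t < 1 -> -1 <= s' <= 1 -> -1 <= t' <= 1 ->
  chord k d s t = chord k d s' t' -> s = s' /\ t = t'.
Proof.
move=> kpi.
have pi0 : 0 < pi by exact: pi_gt0.
(* Two chords with parameters a < b do not cross: both endpoints of the first lie on
   the same closed side of the second, and not both on it. *)
have main a b x y : -1 < a -> b < 1 -> -1 < x < 1 ->
    a < b -> chord k d a x <> chord k d b y.
  move=> a1 b1 xI ab /(congr1 (rotation (- (k * b + d)))).
  rewrite /chord rotKN -rotD => /(congr1 snd).
  have -> : - (k * b + d) + (k * a + d) = - (k * (b - a)) by ring.
  set D := k * (b - a); rewrite /rotation /= sinN cosN => eqD.
  have Dle : `|D| <= pi / 2 * (b - a).
    by rewrite /D normrM (gtr0_norm (x := b - a)) ?subr_gt0 // ler_pM2r ?subr_gt0.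
  have {}Dle : - (pi / 2 * (b - a)) <= D <= pi / 2 * (b - a) by rewrite -ler_norml.
  have inc E : - (pi / 2 * (b - a)) <= E -> E <= pi / 2 * (b - a) ->
      E < pi / 2 * (b - a) -> sin (pi / 2 * a + E) < sin (pi / 2 * b).
    by move=> E1 E2 E3; apply: sin_lt; nra.
  have weak E : - (pi / 2 * (b - a)) <= E -> E <= pi / 2 * (b - a) ->
      sin (pi / 2 * a + E) <= sin (pi / 2 * b).
    move=> E1 E2; have [E3|E3] := ltP E (pi / 2 * (b - a)); first exact/ltW/inc.
    have -> : E = pi / 2 * (b - a) by lra.
    by rewrite (_ : _ + _ = pi / 2 * b) //; ring.
  have pos : 0 < pi / 2 * (b - a) by rewrite mulr_gt0 ?subr_gt0 // divr_gt0.
  have w1 : sin (pi / 2 * a + D) <= sin (pi / 2 * b) by apply: weak; lra.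
  have w2 : sin (pi / 2 * a - D) <= sin (pi / 2 * b) by apply: weak; lra.
  have strict : sin (pi / 2 * a + D) < sin (pi / 2 * b) \/
                sin (pi / 2 * a - D) < sin (pi / 2 * b).
    by have [D0|D0] := ltP D (pi / 2 * (b - a)); [left|right]; apply: inc; lra.
  (* With chord b turned horizontal, [eqD] equates sin(pi b/2) with the average of sin(pi a/2 + D)
     and sin(pi a/2 - D) weighted by (1 + x)/2 and (1 - x)/2. Both weights are positive, and both
     values are at most sin(pi b/2), one of them strictly. *)
  move: w1 w2 strict; rewrite sinD sinB => w1 w2 strict.
  move: eqD w1 w2 strict.
  set A := sin (pi / 2 * a); set C := cos (pi / 2 * a).
  set B := sin (pi / 2 * b) => eqD w1 w2 strict.
  by case: strict => [w|w]; nra.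
move=> sI tI sI' tI' eqc.
(* Comparing norms shows that the second point is interior too, so [s'] and [t'] are also strictly
   inside their intervals and [main] applies in either order. *)
have eqn := congr1 sqnorm eqc; rewrite /chord !sqnorm_rot !sqnorm_lens in eqn.
have lhs0 : 0 < (1 - t ^+ 2) * cos (pi / 2 * s) ^+ 2.
  by rewrite mulr_gt0 ?exprn_gt0 ?cos_pihalfM_gt0 //; nra.
have rhs0 : 0 < (1 - t' ^+ 2) * cos (pi / 2 * s') ^+ 2 by lra.
have s'1 : -1 < s' < 1.
  have cN0 : cos (pi / 2 * s') != 0.
    by apply/eqP => c0; move: rhs0; rewrite c0 expr0n mulr0 ltxx.
  have sN1 : s' != 1.
    by apply: contra_neqN cN0 => /eqP ->; rewrite mulr1 cos_pihalf.
  have sNN1 : s' != -1.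
    by apply: contra_neqN cN0 => /eqP ->; rewrite mulrN1 cosN cos_pihalf.
  by move/andP: sI' => [s1 s2]; rewrite !lt_neqAle s1 s2 sN1 eq_sym sNN1.
have t'1 : -1 < t' < 1.
  have := cos_pihalfM_gt0 s'1 => c0; have {}c0 := exprn_gt0 2 c0.
  have : 0 < 1 - t' ^+ 2 by move: rhs0; rewrite pmulr_lgt0.
  by nra.
have ss : s = s'.
  have [/andP[sl su] /andP[sl' su']] := (sI, s'1).
  have [lt_ss|lt_ss|//] := ltgtP s s'.
    by have := main s s' t t' sl su' tI lt_ss eqc.
  by have := main s' s t' t sl' su t'1 lt_ss (esym eqc).
split=> //; move: eqc; rewrite ss /chord => /(congr1 (rotation (- (k * s' + d)))).
rewrite !rotKN => /(congr1 fst) /= /mulIf; apply.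
by rewrite gt_eqF // cos_pihalfM_gt0.
Qed.

(** Turn z back by k s + d: it lies on chord s once its height is - sin(pi s/2). Its height stays in
    [-1, 1] while the sine runs from -1 to 1, so the intermediate value theorem provides s. *)
Lemma chord_surj k d z : `|k| <= pi / 2 -> sqnorm z <= 1 ->
  exists s t, [/\ -1 <= s <= 1, -1 <= t <= 1 & chord k d s t = z].
Proof.
move=> kpi z1.
pose h s := (rotation (- (k * s + d)) z).2 + sin (pi / 2 * s).
have hc : continuous h.
  have lin (e c : R) : continuous (fun s => e * s + c).
    apply: addr_continuous => [|?]; last exact: cst_continuous.
    by apply: mulr_continuous => ?; [exact: cst_continuous|exact: cvg_id].
  apply: addr_continuous.
    apply: addr_continuous; apply: mulr_continuous; try by move=> ?; exact: cst_continuous.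
      exact: (comp_continuous (oppr_continuous (lin k d)) (@continuous_sin R)).
    exact: (comp_continuous (oppr_continuous (lin k d)) (@continuous_cos R)).
  rewrite [X in continuous X](_ : _ = sin \o (fun s => pi / 2 * s + 0)).
    exact: (comp_continuous (lin (pi / 2) 0) (@continuous_sin R)).
  by apply/funext => s /=; rewrite addr0.
have bnd s : -1 <= (rotation (- (k * s + d)) z).2 <= 1.
  have := sqnorm_rot (- (k * s + d)) z; rewrite /sqnorm.
  set X := rotation _ z => eqX; rewrite /sqnorm in z1.
  by have := sqr_ge0 X.1; nra.
have [||s sI hs] := @IVT R h (-1) 1 0 _ (continuous_subspaceT hc).
- by lra.
- rewrite /h (mulrN1 (pi / 2)) (mulr1 (pi / 2)) sinN sin_pihalf ge_min le_max.
  by have := bnd (-1); have := bnd 1; move=> /andP[? ?] /andP[? ?]; lra.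
rewrite in_itv /= in sI.
have := sqnorm_rot (- (k * s + d)) z.
case E: (rotation _ z) => [x y]; rewrite /sqnorm /= => eqX.
have yE : y = - sin (pi / 2 * s) by move: hs; rewrite /h E /=; lra.
have xc : x ^+ 2 <= cos (pi / 2 * s) ^+ 2.
  move: z1; rewrite /sqnorm -eqX yE sqrrN (cos2sin2 (pi / 2 * s)); lra.
have c0 : 0 <= cos (pi / 2 * s).
  have pi0 : 0 < pi by exact: pi_gt0.
  by apply: cos_ge0_pihalf; move/andP: sI => [? ?]; apply/andP; split; nra.
have [t [tI tx]] : exists t, -1 <= t <= 1 /\ t * cos (pi / 2 * s) = x.
  move: xc; have [->|cN0] := eqVneq (cos (pi / 2 * s)) 0 => xc.
    (* Here the chord has shrunk to a point, so the choice of t is arbitrary. *)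
    exists 0; split; first by lra.
    by apply/esym/eqP; rewrite mul0r -sqrf_eq0 eq_le sqr_ge0 andbT (le_trans xc) // expr0n.
  have cp : 0 < cos (pi / 2 * s) by rewrite lt_neqAle eq_sym cN0.
  exists (x / cos (pi / 2 * s)); split; last by rewrite divfK.
  by rewrite ler_pdivlMr // ler_pdivrMr // mulN1r mul1r; apply/andP; split; nra.
exists s, t; split=> //.
rewrite -[RHS](rotNK (k * s + d)) E /chord /lens tx yE //.
Qed.

(** Angles are counted in full turns. Injectivity is required only at interior points, since the top
    arc of a one-letter relator is a point. *)
Record bigon_chart (th1 th2 : R -> R) (B : R * R -> R * R) : Prop := {
  bigon_continuous : continuous B;
  bigon_bot : forall u, 0 <= u <= 1 -> B (u, 0) = turn (th1 u);
  bigon_top : forall u, 0 <= u <= 1 -> B (u, 1) = turn (th2 u);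
  bigon_side : forall u t t', u = 0 \/ u = 1 -> B (u, t) = B (u, t');
  bigon_disk : forall u t, 0 <= u <= 1 -> 0 <= t <= 1 -> sqnorm (B (u, t)) <= 1;
  bigon_int : forall u t, 0 < u < 1 -> 0 < t < 1 -> sqnorm (B (u, t)) < 1;
  bigon_inj : forall u t u' t', 0 < u < 1 -> 0 < t < 1 ->
    0 <= u' <= 1 -> 0 <= t' <= 1 -> B (u, t) = B (u', t') -> u = u' /\ t = t';
  bigon_surj : forall z, sqnorm z <= 1 ->
    exists u t, [/\ 0 <= u <= 1, 0 <= t <= 1 & B (u, t) = z] }.

Lemma chart_exists (L : nat) (a : R) : (0 < L)%N ->
  exists B, bigon_chart (fun u => a + u / L%:R) (fun u => a - (1 - L%:R^-1) * u) B.
Proof.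
move=> L0; have pi0 : 0 < pi by exact: pi_gt0.
(* With s = 2u - 1, the end t = -1 of the chord must have angle 2 pi (a + u/L), which forces k +
   pi/2 = pi/L and fixes d. The end t = 1 then sweeps the complementary arc. *)
pose k := pi / L%:R - pi / 2; pose d := 2 * pi * a + pi / L%:R - pi.
have kpi : `|k| <= pi / 2.
  rewrite /k ler_norml; apply/andP; split.
    by have : 0 <= pi / L%:R; [rewrite divr_ge0 // ltW|lra].
  have : pi / L%:R <= pi.
    by rewrite ler_pdivrMr ?ltr0n // ler_peMr ?ler1n // ltW.
  by lra.
exists (fun p => chord k d (2 * p.1 - 1) (2 * p.2 - 1)); split.
- have lin (e c : R) (f : R * R -> R) : continuous f -> continuous (fun p => e * f p + c).
    move=> fc; apply: addr_continuous => [|?]; last exact: cst_continuous.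
    by apply: mulr_continuous => // ?; exact: cst_continuous.
  have cs : continuous (fun p : R * R => 2 * p.1 - 1) by exact/lin/fst_continuous.
  have ct : continuous (fun p : R * R => 2 * p.2 - 1) by exact/lin/snd_continuous.
  have cang : continuous (fun p : R * R => k * (2 * p.1 - 1) + d) by exact: lin.
  have cpi : continuous (fun p : R * R => pi / 2 * (2 * p.1 - 1)).
    by apply: mulr_continuous => // ?; exact: cst_continuous.
  have ccos f : continuous f -> continuous (fun p : R * R => cos (f p) : R).
    by move=> fc; exact: (comp_continuous fc (@continuous_cos R)).
  have csin f : continuous f -> continuous (fun p : R * R => sin (f p) : R).
    by move=> fc; exact: (comp_continuous fc (@continuous_sin R)).
  have cl1 : continuous (fun p : R * R => (2 * p.2 - 1) * cos (pi / 2 * (2 * p.1 - 1))).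
    exact/mulr_continuous/ccos.
  have cl2 : continuous (fun p : R * R => - sin (pi / 2 * (2 * p.1 - 1))).
    exact/oppr_continuous/csin.
  apply: pair_continuous; (apply: addr_continuous; last try apply: oppr_continuous);
    by apply: mulr_continuous => //; (apply: ccos || apply: csin).
- move=> u uI; rewrite /= /chord /turn.
  have -> : 2 * pi * (a + u / L%:R) = (k * (2 * u - 1) + d) + pi / 2 * (2 * u - 1) + pi.
    by rewrite /k /d; field; rewrite pnatr_eq0 -lt0n.
  set f := _ + d; set g := pi / 2 * _.
  by rewrite cosDpi sinDpi (cosD f g) (sinD f g) /rotation /lens /=; congr (_, _); ring.
- move=> u uI; rewrite /= /chord /turn.
  have -> : 2 * pi * (a - (1 - L%:R^-1) * u) = (k * (2 * u - 1) + d) - pi / 2 * (2 * u - 1).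
    by rewrite /k /d; field; rewrite pnatr_eq0 -lt0n.
  set f := _ + d; set g := pi / 2 * _.
  by rewrite (cosB f g) (sinB f g) /rotation /lens /=; congr (_, _); ring.
- move=> u t t' u01; rewrite /chord /lens /=.
  have -> : cos (pi / 2 * (2 * u - 1)) = 0.
    case: u01 => ->; last by rewrite (_ : _ * _ = pi / 2) ?cos_pihalf //; ring.
    by rewrite (_ : _ * _ = - (pi / 2)) ?cosN ?cos_pihalf //; ring.
  by rewrite !mulr0.
- move=> u t uI tI; rewrite sqnorm_rot sqnorm_lens /=.
  by rewrite lerBlDr lerDl mulr_ge0 ?sqr_ge0 //; nra.
- move=> u t uI tI; rewrite sqnorm_rot sqnorm_lens /=.
  rewrite ltrBlDr ltrDl mulr_gt0 //; first by nra.
  by rewrite exprn_gt0 // cos_pihalfM_gt0 //; lra.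
- move=> u t u' t' uI tI uI' tI' /= e.
  by have [||||? ?] := chord_inj kpi _ _ _ _ e; [lra|lra|lra|lra|split; lra].
- move=> z /(chord_surj d kpi)[s [t [sI tI <-]]].
  exists ((s + 1) / 2), ((t + 1) / 2); split; [lra|lra|].
  by rewrite /=; congr chord; field.
Qed.

(** For the second presentation, where the distinguished letter occurs inverted and its arc is read
    backwards. *)
Lemma chart_rev th1 th2 B : bigon_chart th1 th2 B ->
  bigon_chart (fun u => th1 (1 - u)) (fun u => th2 (1 - u)) (fun p => B (1 - p.1, p.2)).
Proof.
case=> Bc b0 b1 bs bd bn bi bS.
split=> [|u uI|u uI|u t t' u01|u t uI tI|u t uI tI|u t u' t'|z].
- apply: (comp_continuous (f := fun p : R * R => (1 - p.1, p.2)) _ Bc).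
  apply: (pair_continuous _ (@snd_continuous _ _)).
  apply: addr_continuous; first by move=> ?; exact: cst_continuous.
  exact: (oppr_continuous (@fst_continuous _ _)).
- by rewrite /=; apply: b0; lra.
- by rewrite /=; apply: b1; lra.
- by rewrite /=; apply: bs; case: u01 => ->; [right|left]; ring.
- by rewrite /=; apply: bd => //; lra.
- by rewrite /=; apply: bn => //; lra.
- move=> uI tI uI' tI' /= e.
  by have [||||? ?] := bi _ _ _ _ _ _ _ _ e; [lra|lra|lra|lra|split; lra].
- move=> /bS[u [t [uI tI <-]]]; exists (1 - u), t; split=> //=; first lra.
  by congr (B (_, _)); ring.
Qed.

End Bigon.

(** * The complex of a presentation as a mapping torus *)

Section Loop.
Variable R : realType.
Local Notation pi := (@trigo.pi R).

Lemma turnDint (th : R) (m : int) : turn (th + m%:~R) = turn th.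
Proof.
have turnDnat x (k : nat) : turn (x + k%:R) = turn x :> R * R.
  elim: k => [|k <-]; first by rewrite addr0.
  have turn1 : 2 * pi * (x + k.+1%:R) = 2 * pi * (x + k%:R) + pi *+ 2.
    by rewrite -natr1 -mulr_natl; ring.
  by rewrite /turn turn1 cosD2pi sinD2pi.
case: m => k; first exact: turnDnat.
by rewrite NegzE mulrNz -pmulrn -[in RHS](subrK k.+1%:R th) turnDnat.
Qed.

Lemma turn_eq (a b : R) : turn a = turn b -> exists m : int, a = b + m%:~R.
Proof.
case=> cab sab; exists (Num.floor (a - b)).
set D := a - b; set f := D - (Num.floor D)%:~R.
suff f0 : f = 0 by move: f0; rewrite /f /D; lra.
have [f_ge0 f_lt1] : 0 <= f /\ f < 1.
  by have := floor_itv D; rewrite /f intrD; lra.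
apply/eqP; rewrite eq_le f_ge0 andbT leNgt; apply/negP => f_gt0.
have pi0 : 0 < pi by exact: pi_gt0.
have cosD1 : cos (2 * pi * D) = 1.
  rewrite /D mulrBr cosB cab sab -!expr2; exact: cos2Dsin2.
have [cosf _] := turnDint f (Num.floor D).
move: cosf; rewrite subrK cosD1.
(* By the double angle formula, cos(2 pi f) = 1 forces sin(pi f) = 0, which is impossible for 0 < f
   < 1. *)
have -> : 2 * pi * f = (pi * f) *+ 2 by rewrite -mulr_natl; ring.
rewrite cos_mulr2n cos2sin2 -mulr_natl => /eqP cosf.
have s0 : 0 < sin (pi * f) by apply: sin_gt0_pi; apply/andP; split; nra.
by move/eqP: cosf; nra.
Qed.

(** The attaching map of a disk with boundary word [w]; removing the floor makes it depend only on
    the point [turn th] of the circle. *)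
Definition loop_at (w : word) (th : R) : int * R :=
  path_at w ((size w)%:R * (th - (Num.floor th)%:~R)).

Lemma loop_at_turn w (a b : R) : turn a = turn b -> loop_at w a = loop_at w b.
Proof.
move=> /turn_eq[m ->]; rewrite /loop_at floorDrz // intrKfloor intrD.
by congr path_at; congr (_ * _); ring.
Qed.

Lemma loop_at_id w (a : R) : 0 <= a < 1 -> loop_at w a = path_at w ((size w)%:R * a).
Proof.
by move=> aI; rewrite /loop_at (@floor_def _ _ 0) ?subr0 // add0r.
Qed.

End Loop.

Section Complex.
Variables (R : realType) (n : nat) (rels : seq word).
Local Notation cells := (set_type (@cell_pt R n rels)).
Local Notation K := (complex2 R n rels).
Local Notation quo := {eq_quot (cglue_rel R n rels)}%qT.

Definition vertex : cells :=
  @exist _ _ (0%N, (0, 0)) (mem_set (erefl : cell_pt n rels (0%N, (0, 0)))).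

Definition cell (x : nat * (R * R)) : cells :=
  if pselect (cell_pt n rels x) is left cx then exist _ x (mem_set cx) else vertex.

Lemma cellK x : cell_pt n rels x -> set_val (cell x) = x.
Proof. by rewrite /cell; case: pselect. Qed.

Definition pt (x : nat * (R * R)) : K := \pi_quo%qT (cell x).

Lemma pt_glue x y : cell_pt n rels x -> cell_pt n rels y ->
  Defs.glue n rels x y -> pt x = pt y.
Proof.
move=> cx cy xy; apply/eqmodP/asboolP; rewrite /cglue !cellK //.
exact: rst_step.
Qed.

Lemma pt_surj (c : K) : exists2 x, cell_pt n rels x & c = pt x.
Proof.
exists (set_val (repr (c : quo))).
  exact: set_valP.
rewrite -[LHS](@reprK _ quo); congr (\pi _)%qT.
apply: val_inj; exact: (esym (cellK (set_valP _))).
Qed.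

Lemma pt_continuous (X : topologicalType) (h : X -> nat * (R * R)) :
  continuous h -> (forall x, cell_pt n rels (h x)) -> continuous (fun x => pt (h x)).
Proof.
move=> hc hcell; apply: (comp_continuous (f := fun x => cell (h x)) _
  (@pi_continuous _ quo)).
apply: continuous_comp_initial.
by rewrite (_ : set_val \o _ = h) //; apply/funext => x; rewrite /= cellK.
Qed.

(** Universal property of the complex: a map out of it is one map per cell, compatible with the
    generating gluings. *)
Lemma complex_lift (W : topologicalType) (Phi : nat -> R * R -> W) :
  (forall i, continuous (Phi i)) ->
  (forall x y, Defs.glue n rels x y -> Phi x.1 x.2 = Phi y.1 y.2) ->
  exists2 F : K -> W, continuous F &
    forall x, cell_pt n rels x -> F (pt x) = Phi x.1 x.2.
Proof.
move=> Phic Phiglue.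
pose g (c : cells) := Phi (set_val c).1 (set_val c).2.
have gE (c c' : cells) : cglue c c' -> g c = g c'.
  by rewrite /cglue /g; elim=> [x y /Phiglue|x|x y _ ->|x y z _ -> _ ->].
have gc : continuous g.
  apply: (comp_continuous (f := set_val) (g := fun x => Phi x.1 x.2)).
    exact: initial_continuous.
  (* The index set is discrete, so near (i, z) only [Phi i] matters. *)
  move=> [i z]; apply: (@cvg_trans _ ((Phi i \o snd) @ (i, z))).
    apply: near_eq_cvg; exists ([set i], setT); first by split => //=; exact: filterT.
    by move=> [j y] [/= -> _].
  exact: (comp_continuous (@snd_continuous _ _) (Phic i)).
exists (g \o (repr : quo -> cells)).
  apply: (repr_comp_continuous (Q0 := quo) gc).
  move=> c c' /eqP cc'; apply/eqP/gE; apply/asboolP; apply/(@eqmodP _ (cglue_rel R n rels)).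
  exact: cc'.
move=> x cx; rewrite /= -[RHS](_ : g (cell x) = _); last by rewrite /g cellK.
apply: gE; apply/asboolP; apply/(@eqmodP _ (cglue_rel R n rels)).
exact: reprK.
Qed.

End Complex.

(** * Descending maps from the square to the disk *)

Section DiskMaps.
Variables (R : realType) (th1 th2 : R -> R) (B : R * R -> R * R).
Hypothesis chartB : bigon_chart th1 th2 B.

(* Identity on the disk, inversion in the unit circle outside. *)
Definition retract (z : R * R) : R * R :=
  (z.1 / Num.max 1 (sqnorm z), z.2 / Num.max 1 (sqnorm z)).

Lemma sqnorm_continuous : continuous (@sqnorm R).
Proof.
by apply: addr_continuous; apply: mulr_continuous;
  (exact: fst_continuous || exact: snd_continuous).
Qed.

Lemma retract_id z : sqnorm z <= 1 -> retract z = z.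
Proof. by case: z => x y z1; rewrite /retract (max_idPl z1) !divr1. Qed.

Lemma sqnorm_retract z : sqnorm (retract z) <= 1.
Proof.
have [z1|/ltW z1] := leP (sqnorm z) 1; first by rewrite retract_id.
rewrite /retract (max_idPr z1); set N := sqnorm z in z1 *.
have N0 : 0 < N by lra.
rewrite /sqnorm /= !expr_div_n -mulrDl -/(sqnorm z) -/N.
by rewrite ler_pdivrMr ?exprn_gt0 // mul1r expr2 ler_peMr // ltW.
Qed.

Lemma retract_continuous : continuous retract.
Proof.
have M0 (z : R * R) : Num.max 1 (sqnorm z) != 0 by rewrite gt_eqF // lt_max ltr01.
have m1 : continuous (fun x : R => Num.max 1 x).
  by move=> x; apply: continuous_max; [exact: cst_continuous|exact: cvg_id].
have Mc : continuous (fun z : R * R => (Num.max 1 (sqnorm z))^-1).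
  move=> z; apply: (cvgV (M0 z)); exact: (comp_continuous sqnorm_continuous m1).
by apply: pair_continuous; apply: mulr_continuous => //;
  (exact: fst_continuous || exact: snd_continuous).
Qed.

Definition frontier_pt (p : R * R) := [\/ p.1 = 0, p.1 = 1, p.2 = 0 | p.2 = 1].

Lemma frontierP (p : R * R) : 0 <= p.1 <= 1 -> 0 <= p.2 <= 1 ->
  (0 < p.1 < 1 /\ 0 < p.2 < 1) \/ frontier_pt p.
Proof.
rewrite /frontier_pt => /andP[u0 u1] /andP[t0 t1].
have [->|p10] := eqVneq p.1 0; first by right; exact: Or41.
have [->|p11] := eqVneq p.1 1; first by right; exact: Or42.
have [->|p20] := eqVneq p.2 0; first by right; exact: Or43.
have [->|p21] := eqVneq p.2 1; first by right; exact: Or44.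
by left; rewrite !lt_neqAle u0 u1 t0 t1 p11 p21 ![0 == _]eq_sym p10 p20.
Qed.

Lemma frontier_turn p : 0 <= p.1 <= 1 -> frontier_pt p -> exists a, B p = turn a.
Proof.
case: p => u t /= uI [] /= e.
- exists (th1 u); rewrite (bigon_side chartB _ 0) ?(bigon_bot chartB) //; by left.
- exists (th1 u); rewrite (bigon_side chartB _ 0) ?(bigon_bot chartB) //; by right.
- by exists (th1 u); rewrite e (bigon_bot chartB).
- by exists (th2 u); rewrite e (bigon_top chartB).
Qed.

(** The chart maps a compact square onto a Hausdorff disk, hence is a quotient map. Fibres over
    images of interior points are singletons, so compatibility is needed only on the frontier. *)
Lemma disk_map (W : topologicalType) (E : R * R -> W) : continuous E ->
  (forall p p', 0 <= p.1 <= 1 -> 0 <= p.2 <= 1 -> frontier_pt p ->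
     0 <= p'.1 <= 1 -> 0 <= p'.2 <= 1 -> frontier_pt p' -> B p = B p' -> E p = E p') ->
  exists2 G : R * R -> W, continuous G &
    forall u t, 0 <= u <= 1 -> 0 <= t <= 1 -> G (B (u, t)) = E (u, t).
Proof.
move=> Ec Efront.
have fibre p p' : 0 <= p.1 <= 1 -> 0 <= p.2 <= 1 -> 0 <= p'.1 <= 1 ->
    0 <= p'.2 <= 1 -> B p = B p' -> E p = E p'.
  case: p p' => [u t] [u' t'] /= uI tI uI' tI' e.
  have [[/= u1 t1]|fp] := frontierP (p := (u, t)) uI tI.
    by have [-> ->] := bigon_inj chartB u1 t1 uI' tI' e.
  have [[/= u1 t1]|fp'] := frontierP (p := (u', t')) uI' tI'; last exact: Efront.
  by have [-> ->] := bigon_inj chartB u1 t1 uI tI (esym e).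
have /boolp.choice[sec secP] (z : R * R) : exists p : R * R, sqnorm z <= 1 ->
    [/\ 0 <= p.1 <= 1, 0 <= p.2 <= 1 & B p = z].
  have [z1|] := boolP (sqnorm z <= 1); last by exists (0, 0).
  by have [u [t [uI tI e]]] := bigon_surj chartB z1; exists (u, t).
exists (fun z => E (sec (retract z))).
  apply/continuous_closedP => C cC.
  pose I2 : set (R * R) := `[0, 1] `*` `[0, 1].
  (* The preimage of a closed set is pulled back along [retract] from the image under [B] of a
     compact set, which is closed. *)
  have -> : (fun z => E (sec (retract z))) @^-1` C =
      retract @^-1` (B @` (I2 `&` E @^-1` C)).
    apply/seteqP; split=> z /= => [Cz|[p [[pI1 pI2] Ep] Bp]].
      have [uI tI e] := secP _ (sqnorm_retract z).
      by exists (sec (retract z)) => //; split=> //; split; rewrite /= in_itv.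
    have [uI tI e] := secP _ (sqnorm_retract z).
    by rewrite (fibre _ p) // ?e //; rewrite /= in_itv in pI1 pI2.
  move/continuous_closedP: retract_continuous; apply.
  apply: compact_closed; first exact: norm_hausdorff.
  apply: continuous_compact; first exact/continuous_subspaceT/(bigon_continuous chartB).
  apply: compact_closedI; last by move/continuous_closedP: Ec; apply.
  by apply: compact_setX; exact: segment_compact.
move=> u t uI tI; have B1 := bigon_disk chartB uI tI.
by rewrite retract_id //; have [] := secP _ B1 => *; exact: fibre.
Qed.

End DiskMaps.

(** * Presentation complexes whose relators express a monodromy *)

Section ComplexTorus.
Variables (R : realType) (n : nat) (rels : seq word) (f : int * R -> int * R).
Variables (th1 th2 : R -> R) (B : R * R -> R * R) (disk : int -> nat).
Local Notation rel a := (nth [::] rels (disk a)).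
Hypotheses (n_gt0 : (0 < n)%N) (fI : forall p, 0 <= p.2 <= 1 -> 0 <= (f p).2 <= 1).
Hypothesis chartB : bigon_chart th1 th2 B.
Hypothesis diskE : forall a b, disk a = disk b <-> (a = b %[mod n%:Z])%Z.
Hypothesis disk_lt : forall a, (disk a < size rels)%N.
Hypothesis disk_surj : forall j, (j < size rels)%N -> exists a, disk a = j.
Hypothesis rel_neq0 : forall j, (j < size rels)%N -> nth [::] rels j <> [::].
Hypothesis rel_bot : forall a u, 0 <= u <= 1 ->
  same_point n (loop_at (rel a) (th1 u)) (a, u).
Hypothesis rel_top : forall a u, 0 <= u <= 1 ->
  same_point n (loop_at (rel a) (th2 u)) (f (a, u)).

Local Notation pt := (@pt R n rels).
Local Notation edge p := (pt (edge_index n p.1, (p.2, 0))).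

Lemma edge_index_mod a b :
  (edge_index n a = edge_index n b) <-> (a = b %[mod n%:Z])%Z.
Proof.
have n0 : n%:Z != 0 by rewrite eqz_nat -lt0n.
have modE : (a - 1 = b - 1 %[mod n%:Z])%Z <-> (a = b %[mod n%:Z])%Z.
  by split=> /eqP h; apply/eqP; move: h; rewrite !eqz_mod_dvd opprB addrA subrK.
split=> [[e]|/modE e]; last by rewrite /edge_index e.
apply/modE; move: e => /(congr1 Posz).
by rewrite !gez0_abs ?modz_ge0.
Qed.

Lemma edge_index_itv a : (0 < edge_index n a <= n)%N.
Proof.
rewrite /edge_index /= -ltz_nat gez0_abs ?modz_ge0 ?ltz_pmod //.
by rewrite eqz_nat -lt0n.
Qed.

Lemma edge_index_nat i : (0 < i <= n)%N -> edge_index n i%:Z = i.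
Proof.
case: i => // i; rewrite /= => lt_in.
by rewrite /edge_index intS addrAC subrr add0r modz_small.
Qed.

Lemma cell_edge (p : int * R) : 0 <= p.2 <= 1 ->
  cell_pt n rels (edge_index n p.1, (p.2, 0)).
Proof.
move=> pI; have /andP[i0 iI] := edge_index_itv p.1.
by rewrite /cell_pt /= iI.
Qed.

Lemma cell_disk a (z : R * R) : sqnorm z <= 1 ->
  cell_pt n rels ((n + disk a).+1, z).
Proof.
move=> z1; rewrite /cell_pt /= ltnNge leq_addr /=.
by rewrite -addnS leq_add2l disk_lt.
Qed.

Lemma cell_vertex : cell_pt n rels (0%N, (0, 0) : R * R).
Proof. by []. Qed.

Lemma edge_endpoint (p : int * R) : endpoint p -> edge p = pt (0%N, (0, 0)).
Proof.
move=> pe; have pI : 0 <= p.2 <= 1 by case: pe => ->; rewrite ?lexx ?ler01.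
apply: pt_glue; [exact: cell_edge|exact: cell_vertex|].
by case: pe => ->; [apply: glue_edge0|apply: glue_edge1]; exact: edge_index_itv.
Qed.

Lemma edge_same (p q : int * R) : same_point n p q -> edge p = edge q.
Proof.
case=> [[pq ->]|[pe qe]]; last by rewrite !edge_endpoint.
by have /edge_index_mod -> := pq.
Qed.

(** Brings any angle into the form required by [glue_seg]: t and u are the integer and fractional
    parts of the time elapsed along the word. *)
Lemma loop_glue j (a : R) : (j < size rels)%N -> exists b (t : nat) (u : R),
  [/\ turn a = turn b, (t < size (nth [::] rels j))%N, 0 <= u < 1,
      b = (t%:R + u) / (size (nth [::] rels j))%:R &
      loop_at (nth [::] rels j) a =
      ((nth (0, false) (nth [::] rels j) t).1,
       if (nth (0, false) (nth [::] rels j) t).2 then 1 - u else u)].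
Proof.
move=> jr; set w := nth _ _ _.
have w0 : (0 < size w)%N by rewrite lt0n size_eq0; apply/eqP; exact: rel_neq0.
have L0 : 0 < (size w)%:R :> R by rewrite ltr0n.
pose b := a - (Num.floor a)%:~R.
have /andP[b0 b1] : 0 <= b < 1 by have := floor_itv a; rewrite /b intrD; lra.
pose x := (size w)%:R * b; have x0 : 0 <= x by rewrite mulr_ge0 // ltW.
have /andP[tx xt] := truncn_itv x0.
exists b, (Num.truncn x), (x - (Num.truncn x)%:R).
have tw : (Num.truncn x < size w)%N.
  by rewrite -(ltr_nat R) (le_lt_trans tx) // /x gtr_pMr.
have uI : 0 <= x - (Num.truncn x)%:R < 1 by move: xt; rewrite -natr1; lra.
split=> //; first by rewrite -[a in LHS](subrK (Num.floor a)%:~R) turnDint.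
  by rewrite subrKC /x mulrC mulKf ?gt_eqF.
by rewrite /loop_at -/b -/x -[in LHS](subrKC (Num.truncn x)%:R x) path_at_nth.
Qed.

Lemma pt_disk_turn a (b : R) :
  pt ((n + disk a).+1, turn b) = edge (loop_at (rel a) b).
Proof.
have [c [t [u [-> tw uI cE ->]]]] := loop_glue b (disk_lt a).
have uI' : 0 <= u <= 1 by lra.
apply: pt_glue.
- by apply: cell_disk; rewrite /sqnorm /turn /= cos2Dsin2.
- by apply: cell_edge; case: ifP => _ /=; lra.
- by rewrite cE; case/andP: uI => u0 u1; exact: glue_seg.
Qed.

Definition square (a : int) (p : R * R) : complex2 R n rels :=
  pt ((n + disk a).+1, B (clamp p.1, clamp p.2)).

Lemma square_bot a u : 0 <= u <= 1 -> square a (u, 0) = edge (a, u).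
Proof.
move=> uI; rewrite /square /= (clamp_id uI) clamp_le0 // (bigon_bot chartB) //.
by rewrite pt_disk_turn; apply: (@edge_same _ (a, u)); exact: rel_bot.
Qed.

Lemma square_cyl : cylinders n square.
Proof.
split.
- move=> a; apply: pt_continuous => [|p].
    apply: pair_continuous; first by move=> ?; exact: cst_continuous.
    apply: (comp_continuous (f := fun p : R * R => (clamp p.1, clamp p.2)) _
      (bigon_continuous chartB)).
    by apply: pair_continuous; apply: (comp_continuous _ (@continuous_clamp R));
      [exact: fst_continuous|exact: snd_continuous].
  by apply: cell_disk; apply: (bigon_disk chartB); exact: clamp_itv.
- have side a u t : u = 0 \/ u = 1 -> square a (u, t) = pt (0%N, (0, 0)).
    move=> u01; have uI : 0 <= u <= 1 by case: u01 => ->; rewrite ?lexx ?ler01.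
    rewrite /square /= (clamp_id uI) (bigon_side chartB _ 0) //.
    have := square_bot a uI; rewrite /square /= (clamp_id uI) clamp_le0 // => ->.
    exact: (@edge_endpoint (a, u)).
  by move=> a b u v t t' u01 v01; rewrite !side.
- by move=> a b /diskE ab; apply/funext => p; rewrite /square ab.
Qed.

(** The edge x_a is the bottom of the square over a, so the squares cover every cell. A family [E]
    descends to each disk by [disk_map] and to the edges through its values at height 0. *)
Lemma complex_torus : mapping_torus n f square.
Proof.
split; first exact: square_cyl.
- move=> a u uI; have := fI (p := (a, u)) uI; case fau : (f (a, u)) => [b v] /= vI.
  rewrite square_bot // /square /= (clamp_id uI) clamp_ge1 // (bigon_top chartB) //.
  by rewrite pt_disk_turn; apply: (@edge_same _ (b, v)); rewrite -fau; exact: rel_top.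
- move=> c; have [[i z] cx ->] := pt_surj c; move: cx; rewrite /cell_pt /=.
  case: eqP => [-> ->|/eqP i0].
    exists 0, 0, 0; rewrite lexx ler01; split=> //.
    by rewrite square_bot ?lexx ?ler01 // edge_endpoint //; left.
  case: leqP => [iI|ni].
    case: z => [u y] /= [-> uI]; exists i%:Z, u, 0; rewrite lexx ler01; split=> //.
    by rewrite square_bot // edge_index_nat // lt0n i0.
  case: leqP => // iI z1; have [|a aE] := disk_surj (j := (i - n.+1)%N).
    by rewrite ltn_subLR // addSn ltnS.
  have [u [t [uI tI <-]]] := bigon_surj chartB z1; exists a, u, t; split=> //.
  by rewrite /square /= !clamp_id // aE -addSn subnKC.
- move=> W E cE gE.
  (* On the frontier [E] depends only on what the boundary word reads at that angle. This yields
     both the descent to the disk and the agreement with the edges. *)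
  have Efront a p b : 0 <= p.1 <= 1 -> frontier_pt p -> B p = turn b ->
      E a p = E (loop_at (rel a) b).1 ((loop_at (rel a) b).2, 0).
    have bot u c : 0 <= u <= 1 -> B (u, 0) = turn c ->
        E a (u, 0) = E (loop_at (rel a) c).1 ((loop_at (rel a) c).2, 0).
      move=> uI; rewrite (bigon_bot chartB) // => /loop_at_turn <-.
      apply: (@same_point_cyl _ _ _ _ (a, u) _ _ cE).
      exact/same_point_sym/rel_bot.
    have sd u t : 0 <= u <= 1 -> u = 0 \/ u = 1 -> B (u, t) = turn b ->
        E a (u, t) = E (loop_at (rel a) b).1 ((loop_at (rel a) b).2, 0).
      move=> uI u01; rewrite (bigon_side chartB _ 0) // => Bu.
      by rewrite -(bot u b uI Bu); exact: (cyl_side cE).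
    case: p => u t /= uI [] /= e Bp; [by apply: sd; auto|by apply: sd; auto|..].
      by move: Bp; rewrite e; exact: bot.
    move: Bp; rewrite e (bigon_top chartB) // => /loop_at_turn <-.
    rewrite gE //; apply: (same_point_cyl _ cE).
    exact/same_point_sym/rel_top.
  have /boolp.choice[G GP] (j : nat) : exists G : R * R -> W, continuous G /\
      forall a u t, disk a = j -> 0 <= u <= 1 -> 0 <= t <= 1 -> G (B (u, t)) = E a (u, t).
    have [[a aj]|noa] := pselect (exists a, disk a = j); last first.
      exists (fun=> E 0 (0, 0)); split; first by move=> ?; exact: cst_continuous.
      by move=> a u t aj; case: noa; exists a.
    have [||G Gc GB] := disk_map chartB (E := E a).
    - exact: (cyl_continuous cE).
    - move=> p p' pI1 pI2 fp pI1' pI2' fp' e.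
      have [b Bb] := frontier_turn chartB pI1 fp.
      by rewrite (Efront a p b) // (Efront a p' b) // -e.
    - exists G; split=> // a' u t a'j uI tI; rewrite GB //.
      by rewrite (cyl_mod cE (a := a) (b := a')) //; apply/diskE; rewrite aj.
  pose Phi i (z : R * R) := if i == 0%N then E 0 (0, 0) else
    if (i <= n)%N then E i%:Z (clamp z.1, 0) else G (i - n.+1)%N z.
  have PhiE (p : int * R) : 0 <= p.2 <= 1 ->
      Phi (edge_index n p.1) (p.2, 0) = E p.1 (p.2, 0).
    move=> pI; rewrite /Phi; have /andP[i0 iI] := edge_index_itv p.1.
    rewrite gtn_eqF // iI clamp_id //.
    have -> // : E (edge_index n p.1)%:Z = E p.1.
    apply: (cyl_mod cE); apply/edge_index_mod.
    by rewrite edge_index_nat // i0.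
  have PhiD j z : Phi (n + j).+1 z = G j z.
    by rewrite /Phi /= ltnNge leq_addr /= -addSn addKn.
  have [||F Fc FE] := @complex_lift R n rels W Phi.
  - move=> i; rewrite /Phi; case: eqP => _; first by move=> ?; exact: cst_continuous.
    case: (leqP i n) => _; last by case: (GP (i - n.+1)%N).
    apply: (comp_continuous (f := fun z : R * R => (clamp z.1, 0)) _ (cyl_continuous cE i%:Z)).
    apply: pair_continuous; last by move=> ?; exact: cst_continuous.
    exact: (comp_continuous (@fst_continuous _ _) (@continuous_clamp R)).
  - have Phi0 i u : (0 < i <= n)%N -> u = 0 \/ u = 1 -> Phi i (u, 0) = Phi 0%N (0, 0).
      move=> /andP[i0 iI] u01; rewrite /Phi gtn_eqF // iI /=.
      apply: (cyl_side cE); last by left.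
      by case: u01 => ->; rewrite clamp_id ?lexx ?ler01; auto.
    move=> x y [i iI|i iI|j th jr /rel_neq0 //|j t u jr tw u0 u1 L l th] /=.
    + by apply: Phi0; auto.
    + by apply: Phi0; auto.
    have [a aj] := disk_surj jr.
    have wE : (nth [::] rels j) = rel a by rewrite aj.
    have L0 : 0 < L%:R :> R by rewrite ltr0n (leq_trans _ tw).
    have thI : 0 <= th < 1.
      rewrite /th divr_ge0 ?addr_ge0 //= ltr_pdivrMr // mul1r.
      have : t.+1%:R <= L%:R :> R by rewrite ler_nat.
      by rewrite -natr1; lra.
    have loopE : loop_at (rel a) th = (l.1, if l.2 then 1 - u else u).
      rewrite loop_at_id // -wE -/L /th mulrC divfK ?gt_eqF //.
      by rewrite path_at_nth // u0.
    rewrite PhiD (PhiE (l.1, _)) /=; last by case: ifP; lra.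
    have th1' : sqnorm (turn th) <= 1 by rewrite /sqnorm /turn /= cos2Dsin2.
    have [v [s [vI sI Bvs]]] := bigon_surj chartB th1'.
    have [_ GB] := GP j; rewrite -/(turn th) -Bvs (GB a) //.
    (* A point of the unit circle cannot come from the open square. *)
    have fr : frontier_pt (v, s).
      have [[/= v1 s1]|//] := frontierP (p := (v, s)) vI sI.
      have := bigon_int chartB v1 s1.
      by rewrite Bvs /sqnorm /turn /= cos2Dsin2 ltxx.
    by rewrite (Efront a _ th) // loopE.
  exists F => // a u t uI tI; rewrite /square /= !clamp_id // FE /=.
    by have [_ GB] := GP (disk a); rewrite PhiD (GB a).
  exact/cell_disk/(bigon_disk chartB).
Qed.

End ComplexTorus.

(** * The two cyclic presentations *)

Section Words.
Variables (R : realType) (n : nat).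
Implicit Types (w : word) (s a b k : int) (x u : R).
Local Notation "p ~= q" := (@same_point R n p q) (at level 70).

Definition equivariant (W : int -> word) := forall a s, W (a + s) = wshift s (W a).

Lemma path_at_equivariant W a b x : equivariant W -> (a = b %[mod n%:Z])%Z ->
  path_at (W a) x ~= path_at (W b) x.
Proof.
move=> WE ab; have -> : W a = wshift (a - b) (W b) by rewrite -WE subrKC.
by apply: path_at_wshift; rewrite -eqz_mod_dvd; apply/eqP.
Qed.

Lemma word_map_endpoint W (p : int * R) : endpoint p -> endpoint (word_map W p).
Proof.
rewrite /word_map; case=> ->; first by rewrite mulr0; exact: path_at_le0.
by rewrite mulr1 path_at_ge //; left.
Qed.

Lemma word_map_same W p q : equivariant W ->
  p ~= q -> word_map W p ~= word_map W q.
Proof.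
move=> WE [[pq p2]|[pe qe]]; last by apply: endpoint_same; exact: word_map_endpoint.
rewrite /word_map p2 (_ : size (W p.1) = size (W q.1)).
  exact: path_at_equivariant.
by rewrite -[p.1](subrKC q.1) WE size_map.
Qed.

(** They differ only at x = 1, where the loop starts again and the path is exhausted; both are then
    at the base point. *)
Lemma loop_at_path w x : 0 <= x <= 1 ->
  loop_at w x ~= path_at w ((size w)%:R * x).
Proof.
move=> /andP[x0]; rewrite le_eqVlt => /orP[/eqP ->|x1].
  apply: endpoint_same; last by rewrite mulr1 path_at_ge //; left.
  rewrite (loop_at_turn w (b := 0)); last by rewrite -[in LHS](add0r 1) (turnDint _ 1).
  by rewrite loop_at_id ?lexx ?ltr01 // mulr0; exact: path_at_le0.
by rewrite loop_at_id ?x0 //; exact: same_point_refl.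
Qed.

Lemma loop_at_addr1 w x : loop_at w x = loop_at w (x + 1).
Proof. by apply: loop_at_turn; rewrite (turnDint x 1). Qed.

Lemma wshift_cat s w w' : wshift s (w ++ w') = wshift s w ++ wshift s w'.
Proof. exact: map_cat. Qed.

Lemma wshift_winv s w : wshift s (winv w) = winv (wshift s w).
Proof. by rewrite /winv /wshift map_rev -!map_comp. Qed.

Lemma wshift_wpow s w (e : int) : wshift s (wpow w e) = wpow (wshift s w) e.
Proof.
by rewrite /wpow; case: ifP => _; rewrite /wshift map_flatten map_nseq // -wshift_winv.
Qed.

Lemma wshift_flatten s (T : Type) (g : T -> word) (t : seq T) :
  wshift s (flatten [seq g i | i <- t]) = flatten [seq wshift s (g i) | i <- t].
Proof. by rewrite /wshift map_flatten -map_comp. Qed.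

Lemma wshiftD s s' w : wshift s (wshift s' w) = wshift (s' + s) w.
Proof. by rewrite /wshift -map_comp; apply: eq_map => l /=; rewrite addrA. Qed.

Lemma wshift0 w : wshift 0 w = w.
Proof. by rewrite /wshift -[RHS]map_id; apply: eq_map => -[a b] /=; rewrite addr0. Qed.

Lemma wshift_gen s a : wshift s (gen a) = gen (a + s).
Proof. by []. Qed.

(** The homomorphism g on letters. Without free reduction every letter becomes exactly two, which
    keeps track of time. *)
Definition subst_letter (k : int) (l : letter) : word :=
  if l.2 then [:: (l.1 + k, true); (l.1, false)]
  else [:: (l.1, true); (l.1 + k, false)].

Definition subst (k : int) (w : word) : word := flatten [seq subst_letter k l | l <- w].

Lemma subst_cat k w w' : subst k (w ++ w') = subst k w ++ subst k w'.
Proof. by rewrite /subst map_cat flatten_cat. Qed.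

Lemma subst_winv k w : subst k (winv w) = winv (subst k w).
Proof.
elim: w => [//|[a e] w IH]; rewrite winv_cons subst_cat IH.
rewrite /subst /= /winv map_cat rev_cat -/(winv _); congr (_ ++ _).
by case: e.
Qed.

Lemma subst_flatten k (t : seq word) : subst k (flatten t) = flatten [seq subst k w | w <- t].
Proof. by elim: t => [//|w t IH]; rewrite /= subst_cat IH. Qed.

Lemma subst_wpow k w (e : int) : subst k (wpow w e) = wpow (subst k w) e.
Proof. by rewrite /wpow; case: ifP; rewrite subst_flatten map_nseq // subst_winv. Qed.

Lemma size_subst k w : size (subst k w) = (2 * size w)%N.
Proof.
by elim: w => [//|[a e] w IH]; rewrite /= size_cat -/(subst k w) IH mulnS; case: e.
Qed.

Definition letter_pair k a : word := [:: (a, true); (a + k, false)].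

Lemma letter_pair_equivariant k : equivariant (letter_pair k).
Proof. by move=> a s; rewrite /letter_pair /= addrAC. Qed.

Lemma word_map_pair k a u : 0 <= u <= 1 ->
  word_map (letter_pair k) (a, u) =
  if u < 1 / 2 then (a, 1 - 2 * u)
  else if u < 1 then (a + k, 2 * u - 1) else (0, 0).
Proof.
move=> /andP[u0 u1]; rewrite /word_map /=.
have [u2|u2] := ltP u (1 / 2).
  have -> : (1 <= 2 * u) = false by apply/negbTE; rewrite -ltNge; lra.
  by rewrite clamp_id //; lra.
have -> : 1 <= 2 * u by lra.
have [u3|u3] := ltP u 1; last by have -> : 1 <= 2 * u - 1 by lra.
have -> : (1 <= 2 * u - 1) = false by apply/negbTE; rewrite -ltNge; lra.
by rewrite clamp_id //; lra.
Qed.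

(** Matches composition of maps of the wedge with substitution in words: the path is run through
    twice as many letters, so its time doubles. *)
Lemma path_at_subst k w x :
  path_at (subst k w) (2 * x) ~= word_map (letter_pair k) (path_at w x).
Proof.
elim: w x => [|[a e] w IH] x.
  by apply: endpoint_same; [left|apply: word_map_endpoint; left].
have [x1|x1] := leP 1 x.
  rewrite [path_at (_ :: w) x]/= x1.
  have -> : path_at (subst k ((a, e) :: w)) (2 * x) = path_at (subst k w) (2 * (x - 1)).
    rewrite /subst /= -/(subst k w) path_at_cat; last by lra.
    have -> : size (subst_letter k (a, e)) = 2%N by case: e.
    by rewrite mulrBr mulr1; have -> : 2 <= 2 * x by lra.
  exact: IH.
have [x0|x0] := leP x 0.
  apply: endpoint_same; first by apply: path_at_le0; lra.
  exact/word_map_endpoint/path_at_le0.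
rewrite [path_at (_ :: w) x]/= leNgt x1 /= clamp_id; last by lra.
have xI : 0 <= (if e then 1 - x else x) <= 1 by case: e; lra.
rewrite word_map_pair // /subst /= -/(subst k w) path_at_cat; last by lra.
have -> : size (subst_letter k (a, e)) = 2%N by case: (e).
have -> : (2 <= 2 * x) = false by apply/negbTE; rewrite -ltNge; lra.
case: e xI => xI /=.
- have [x2|x2] := leP 1 (2 * x).
    have -> : (1 <= 2 * x - 1) = false by apply/negbTE; rewrite -ltNge; lra.
    rewrite clamp_id; last by lra.
    have [x3|x3] := ltP (1 - x) (1 / 2).
      by left; split => //=; lra.
    have -> : 1 - x < 1 by lra.
    by apply: endpoint_same; rewrite /endpoint /=; left; lra.
  rewrite clamp_id; last by lra.
  have -> : (1 - x < 1 / 2) = false by apply/negbTE; rewrite -leNgt; lra.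
  have -> : 1 - x < 1 by lra.
  by left; split => //=; lra.
- have [x2|x2] := leP 1 (2 * x).
    have -> : (1 <= 2 * x - 1) = false by apply/negbTE; rewrite -ltNge; lra.
    have -> : (x < 1 / 2) = false by apply/negbTE; rewrite -leNgt; lra.
    by rewrite x1 clamp_id; [left|lra].
  have -> : x < 1 / 2 by lra.
  by rewrite clamp_id; [left|lra].
Qed.

End Words.

Section Presentations.
Variables (R : realType) (n r : nat) (k : int) (q eps : nat -> int).
Hypothesis n_gt0 : (0 < n)%N.

(** The word A_a of the overview. *)
Definition power_word (a : int) : word :=
  flatten [seq wpow (gen (a + q0 q j)) (eps j) | j <- iota 0 r].

Lemma power_word_equivariant : equivariant power_word.
Proof.
move=> a s; rewrite /power_word wshift_flatten; congr flatten; apply: eq_map => j.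
by rewrite wshift_wpow wshift_gen addrAC.
Qed.

Lemma wshift_word_x s : wshift s (word_x r k q eps) =
  power_word (1 + s) ++ gen (1 + s + q r) ++ winv (power_word (1 + s + k)).
Proof.
rewrite /word_x !wshift_cat wshift_winv -!/(power_word _) wshift_gen.
by rewrite -!power_word_equivariant ![_ + _ + s]addrAC.
Qed.

Lemma wshift_word_y s : wshift s (word_y r k q eps) =
  subst k (power_word (1 + s)) ++ winv (gen (1 + s + q r)).
Proof.
rewrite /word_y wshift_cat wshift_winv wshift_gen [_ + _ + s]addrAC; congr (_ ++ _).
rewrite wshift_flatten /power_word subst_flatten -map_comp; congr flatten.
apply: eq_map => j; rewrite wshift_wpow /= subst_wpow; congr wpow.
by rewrite /subst /=; congr [:: (_, _); (_, _)]; ring.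
Qed.

(** This is f of the overview, and [x_to_y] is g. *)
Definition y_to_x : int * R -> int * R := word_map (fun a => power_word (a - q r)).
Definition x_to_y : int * R -> int * R := word_map (letter_pair k).

Lemma y_to_x_equivariant : equivariant (fun a => power_word (a - q r)).
Proof. by move=> a s; rewrite addrAC -power_word_equivariant. Qed.

Lemma graph_y_to_x : graph_map n y_to_x.
Proof. by apply: word_map_graph_map; exact: y_to_x_equivariant. Qed.

Lemma graph_x_to_y : graph_map n x_to_y.
Proof. by apply: word_map_graph_map; exact: letter_pair_equivariant. Qed.

Section Shifted.
(** Shifting the word only permutes the relators, up to subscripts mod n; [c] is carried along
    because [word_L] is a shift of an instance of [word_x]. *)
Variable c : int.

(* The 0-based index of the relator in which x_a occurs as the letter x_{1+q_r}. *)
Definition disk (a : int) : nat := (edge_index n (a - q r - c)).-1.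

Lemma diskE a b : disk a = disk b <-> (a = b %[mod n%:Z])%Z.
Proof.
have -> : (a = b %[mod n%:Z])%Z <-> (a - q r - c = b - q r - c %[mod n%:Z])%Z.
  split=> /eqP h; apply/eqP; move: h; rewrite !eqz_mod_dvd;
    by rewrite (_ : a - q r - c - (b - q r - c) = a - b) //; ring.
rewrite -edge_index_mod // /disk; split=> [|-> //].
by rewrite /edge_index /= => ->.
Qed.

Lemma disk_lt a : (disk a < n)%N.
Proof. by have := edge_index_itv n_gt0 (a - q r - c); rewrite /disk; lia. Qed.

Lemma disk_surj j : (j < n)%N -> exists a, disk a = j.
Proof.
move=> jn; exists (j.+1%:Z + q r + c); rewrite /disk.
by rewrite (_ : _ - _ = j.+1%:Z) ?edge_index_nat //; ring.
Qed.

Lemma disk_base a : (1 + (c + (disk a)%:Z) = a - q r %[mod n%:Z])%Z.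
Proof.
have n0 : n%:Z != 0 by rewrite eqz_nat -lt0n.
apply/eqP; rewrite /disk /edge_index /= gez0_abs ?modz_ge0 //.
rewrite addrA modzDmr; apply/eqP; congr (_ %% _)%Z; ring.
Qed.

Lemma nth_cyclic_rels w j : (j < n)%N -> nth [::] (cyclic_rels n w) j = wshift j%:Z w.
Proof.
by move=> jn; rewrite /cyclic_rels (nth_map 0%N) ?size_iota // nth_iota.
Qed.

Lemma size_cyclic_rels w : size (cyclic_rels n w) = n.
Proof. by rewrite size_map size_iota. Qed.

Lemma size_power_word a b : size (power_word a) = size (power_word b).
Proof. by rewrite -[a](subrKC b) power_word_equivariant size_map. Qed.

Local Notation len := (size (power_word 0)).

Lemma y_to_xE (p : int * R) :
  y_to_x p = path_at (power_word (p.1 - q r)) (len%:R * p.2).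
Proof. by rewrite /y_to_x /word_map (size_power_word _ 0). Qed.

(** Starting where the distinguished letter begins and going backwards, the boundary reads A_i^-1
    and then A_{i+k}, the two halves of f(g(x_m)). *)
Lemma torus_x : exists Q : int -> R * R -> cyclic_complex R n (wshift c (word_x r k q eps)),
  mapping_torus n (y_to_x \o x_to_y) Q.
Proof.
set w := wshift c _.
have relE j : (j < n)%N -> nth [::] (cyclic_rels n w) j =
    power_word (1 + (c + j%:Z)) ++ gen (1 + (c + j%:Z) + q r)
      ++ winv (power_word (1 + (c + j%:Z) + k)).
  by move=> jn; rewrite nth_cyclic_rels // wshiftD wshift_word_x.
pose L := (2 * len).+1; pose l : R := len%:R.
have L_gt0 : (0 < L)%N by [].
have LE : L%:R = 2 * l + 1 :> R by rewrite /L -natr1 natrM.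
have l0 : 0 <= l by exact: ler0n.
have Lr0 : 0 < L%:R :> R by rewrite ltr0n.
have divI (x : R) : 0 <= x <= L%:R -> 0 <= x / L%:R <= 1.
  by move=> /andP[x0 xL]; rewrite divr_ge0 ?(ltW Lr0) // ler_pdivrMr // mul1r.
(* The l letters of A_i precede the distinguished letter, whose arc therefore starts at l/L. *)
have [B chartB] := chart_exists (l / L%:R) L_gt0.
have sizeE j : (j < n)%N -> size (nth [::] (cyclic_rels n w) j) = L.
  move=> jn; rewrite relE // !size_cat size_winv /= (size_power_word _ 0).
  by rewrite (size_power_word (_ + k) 0) /L; lia.
exists (@square R n (cyclic_rels n w) B disk); apply: (complex_torus _ _ chartB) => //.
- exact: (graph_map_itv (graph_map_comp graph_y_to_x graph_x_to_y)).
- exact: diskE.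
- by move=> a; rewrite size_cyclic_rels; exact: disk_lt.
- by move=> j; rewrite size_cyclic_rels; exact: disk_surj.
- by move=> j; rewrite size_cyclic_rels => /sizeE; case: nth.
- move=> a u /andP[u0 u1]; have dn := disk_lt a.
  apply: (same_point_trans (loop_at_path _ _ _)).
    by rewrite -mulrDl; apply: divI; rewrite LE; lra.
  rewrite sizeE // relE //; have := disk_base a; set b := 1 + _ => bE.
  rewrite -mulrDl mulrC divfK ?gt_eqF // path_at_cat ?addr_ge0 //.
  rewrite (size_power_word _ 0) -/l lerDl u0.
  have -> : l + u - l = u by ring.
  have [u1'|u1'] := ltP u 1; last first.
    have -> : u = 1 by lra.
    apply: endpoint_same; last by right.
    by rewrite /= lexx subrr; exact: path_at_le0.
  rewrite /= leNgt u1' /= clamp_id ?u0 //; left; split=> //=.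
  by rewrite -modzDml bE modzDml subrK.
- move=> a u uI; have dn := disk_lt a; have /andP[u0 u1] := uI.
  have th2E : l / L%:R - (1 - L%:R^-1) * u = l * (1 - 2 * u) / L%:R.
    by rewrite LE; field; lra.
  rewrite th2E /= /x_to_y word_map_pair //.
  have [u2|u2] := ltP u (1 / 2).
    apply: (same_point_trans (loop_at_path _ _ _)).
      by apply: divI; rewrite LE; nra.
    rewrite sizeE // relE //; have := disk_base a; set b := 1 + _ => bE.
    rewrite mulrC divfK ?gt_eqF // path_at_cat; last by rewrite mulr_ge0 //; lra.
    rewrite (size_power_word _ 0) -/l y_to_xE -/l.
    have [x1|x1] := leP l (l * (1 - 2 * u)); last first.
      exact: (path_at_equivariant _ power_word_equivariant bE).
    apply: endpoint_same; first by apply: path_at_le0; nra.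
    by rewrite path_at_ge; [left|rewrite (size_power_word _ 0)].
  (* From u = 1/2 on the angle is at most 0; a full turn brings it back to [0, 1], into the part
     reading A_{i+k}^-1. *)
  rewrite loop_at_addr1; apply: (same_point_trans (loop_at_path _ _ _)).
    have -> : l * (1 - 2 * u) / L%:R + 1 = (l * (1 - 2 * u) + L%:R) / L%:R.
      by rewrite LE; field; lra.
    by apply: divI; rewrite LE; nra.
  rewrite sizeE // relE //; have := disk_base a; set b := 1 + _ => bE.
  rewrite mulrDr mulr1 [L%:R * _]mulrC divfK ?gt_eqF // path_at_cat; last by rewrite LE; nra.
  rewrite (size_power_word _ 0) -/l LE.
  have -> : l <= l * (1 - 2 * u) + (2 * l + 1) by nra.
  rewrite path_at_cat; last by nra.
  rewrite [size (gen _)]/=.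
  have -> : 1 <= l * (1 - 2 * u) + (2 * l + 1) - l by nra.
  have -> : l * (1 - 2 * u) + (2 * l + 1) - l - 1%:R = l - l * (2 * u - 1) by ring.
  apply: (same_point_trans (path_at_winv _ _ _)).
  rewrite (size_power_word _ 0) -/l subKr.
  have [u3|u3] := ltP u 1; last first.
    apply: endpoint_same; last by apply: word_map_endpoint; left.
    by rewrite path_at_ge; [left|rewrite (size_power_word _ 0) -/l; nra].
  rewrite y_to_xE -/l.
  apply: (path_at_equivariant _ power_word_equivariant).
  by rewrite /= -(modzDml b) bE modzDml addrAC.
Qed.

Lemma torus_y : exists Q : int -> R * R -> cyclic_complex R n (wshift c (word_y r k q eps)),
  mapping_torus n (x_to_y \o y_to_x) Q.
Proof.
set w := wshift c _.
have relE j : (j < n)%N -> nth [::] (cyclic_rels n w) j =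
    subst k (power_word (1 + (c + j%:Z))) ++ winv (gen (1 + (c + j%:Z) + q r)).
  by move=> jn; rewrite nth_cyclic_rels // wshiftD wshift_word_y.
pose L := (2 * len).+1; pose l : R := len%:R.
have L_gt0 : (0 < L)%N by [].
have LE : L%:R = 2 * l + 1 :> R by rewrite /L -natr1 natrM.
have l0 : 0 <= l by exact: ler0n.
have Lr0 : 0 < L%:R :> R by rewrite ltr0n.
have divI (x : R) : 0 <= x <= L%:R -> 0 <= x / L%:R <= 1.
  by move=> /andP[x0 xL]; rewrite divr_ge0 ?(ltW Lr0) // ler_pdivrMr // mul1r.
(* The inverted letter comes last, on the arc from -1/L to 0. After reversal the bottom runs from 0
   to -1/L and the top from 0 to 1 - 1/L, modulo full turns, so the top reads g(A_i) forwards. *)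
have [B0 /chart_rev chartB] := chart_exists (- (L%:R^-1) : R) L_gt0.
set B := (fun p : R * R => B0 _) in chartB.
have sizeE j : (j < n)%N -> size (nth [::] (cyclic_rels n w) j) = L.
  by move=> jn; rewrite relE // size_cat size_subst (size_power_word _ 0) addn1.
exists (@square R n (cyclic_rels n w) B disk); apply: (complex_torus _ _ chartB) => //.
- exact: (graph_map_itv (graph_map_comp graph_x_to_y graph_y_to_x)).
- exact: diskE.
- by move=> a; rewrite size_cyclic_rels; exact: disk_lt.
- by move=> j; rewrite size_cyclic_rels; exact: disk_surj.
- by move=> j; rewrite size_cyclic_rels => /sizeE; case: nth.
- move=> a u /andP[u0 u1]; have dn := disk_lt a.
  rewrite loop_at_addr1.
  have -> : - L%:R^-1 + (1 - u) / L%:R + 1 = (L%:R - u) / L%:R :> R.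
    by rewrite LE; field; lra.
  apply: (same_point_trans (loop_at_path _ _ _)).
    by apply: divI; rewrite LE; lra.
  rewrite sizeE // relE //; have := disk_base a; set b := 1 + _ => bE.
  rewrite mulrC divfK ?gt_eqF // path_at_cat; last by rewrite LE; lra.
  rewrite size_subst (size_power_word _ 0) natrM -/l LE.
  have -> : 2 * l <= 2 * l + 1 - u by lra.
  have -> : 2 * l + 1 - u - 2 * l = 1 - u by ring.
  rewrite /=; have [u1'|u1'] := leP 1 (1 - u).
    by apply: endpoint_same; [left|left => /=; lra].
  rewrite clamp_id; last by lra.
  left; split=> /=; last by ring.
  by rewrite -modzDml bE modzDml subrK.
- move=> a u uI; have dn := disk_lt a; have /andP[u0 u1] := uI.
  rewrite loop_at_addr1.
  have -> : - L%:R^-1 - (1 - L%:R^-1) * (1 - u) + 1 = 2 * (l * u) / L%:R :> R.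
    by rewrite LE; field; lra.
  apply: (same_point_trans (loop_at_path _ _ _)).
    by apply: divI; rewrite LE; nra.
  rewrite sizeE // relE //; have := disk_base a; set b := 1 + _ => bE.
  rewrite mulrC divfK ?gt_eqF // path_at_cat; last by rewrite !mulr_ge0.
  rewrite size_subst (size_power_word _ 0) natrM -/l.
  have [x1|x1] := leP (2 * l) (2 * (l * u)).
    apply: endpoint_same; first by apply: path_at_le0; nra.
    apply: word_map_endpoint; rewrite y_to_xE -/l.
    by rewrite path_at_ge; [left|rewrite (size_power_word _ 0) -/l /=; lra].
  apply: (same_point_trans (path_at_subst _ _ _ _)).
  apply: word_map_same; first exact: letter_pair_equivariant.
  rewrite y_to_xE -/l.
  exact: (path_at_equivariant _ power_word_equivariant bE).
Qed.

End Shifted.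

Lemma cyclic_complex_equivalent (c : int) :
  homotopy_equivalent R (cyclic_complex R n (wshift c (word_x r k q eps)))
                        (cyclic_complex R n (word_y r k q eps)).
Proof.
have [Q KQ] := torus_x c; have [P LP] := torus_y 0.
rewrite wshift0 in P LP.
exact: (mapping_torus_comp_comm graph_y_to_x graph_x_to_y KQ LP).
Qed.

End Presentations.

Lemma power_word1 (r : nat) (q : nat -> int) (a : int) :
  power_word r q (fun=> 1) a = [seq (a + q0 q j, false) | j <- iota 0 r].
Proof. by rewrite -flatten_map1. Qed.

(** * The presentations L_n as a special case *)

Section LPresentation.
Variables (r : nat) (p : nat -> int).

(** Chosen so that the subscript 1 + q_j, shifted by p_0 - 1, becomes p_j + j. *)
Definition L_offset (j : nat) : int := pr r p j + j%:Z - p 0%N.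

Lemma q0_L_offset (j : nat) : (j < r)%N -> q0 L_offset j = p j + j%:Z - p 0%N.
Proof.
rewrite /q0 /L_offset /pr; case: j => [|j] jr /=; last by rewrite ltn_eqF.
by rewrite addr0 subrr.
Qed.

Lemma word_LE : word_L r p = wshift (p 0%N - 1) (word_x r 1 L_offset (fun=> 1)).
Proof.
rewrite wshift_word_x !power_word1 /word_L -[r.+1]addn1 iotaD map_cat add0n -catA.
congr (_ ++ _).
  apply/eq_in_map => j; rewrite mem_iota add0n => /= jr.
  by rewrite q0_L_offset // /pr ltn_eqF //; congr (_, _); ring.
congr (_ ++ _); first by rewrite /= /L_offset /gen; congr [:: (_, _)]; ring.
congr winv; apply/eq_in_map => j; rewrite mem_iota add0n => /= jr.
by rewrite q0_L_offset //; congr (_, _); ring.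
Qed.

Lemma word_LyE : word_Ly r p = word_y r 1 L_offset (fun=> 1).
Proof.
rewrite /word_Ly /word_y; congr (flatten _ ++ _).
  apply/eq_in_map => j; rewrite mem_iota add0n => /= jr.
  by rewrite q0_L_offset //; congr [:: (_, _); (_, _)]; ring.
by rewrite /L_offset; congr (winv (gen _)); ring.
Qed.

End LPresentation.

Theorem theorem3p3 (R : realType) (n r : nat) :
  (2 <= n)%N -> (1 <= r)%N ->
  (forall (k : int) (q eps : nat -> int),
     homotopy_equivalent R (cyclic_complex R n (word_x r k q eps))
                           (cyclic_complex R n (word_y r k q eps))) /\
  (forall p : nat -> int,
     (forall j, (j < r)%N -> 0 <= p j <= (n%:Z - 1)) ->
     homotopy_equivalent R (cyclic_complex R n (word_L r p))
                           (cyclic_complex R n (word_Ly r p))).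
Proof.
move=> n2 _; have n_gt0 : (0 < n)%N by exact: ltnW.
split=> [k q eps|p _].
  by rewrite -[word_x r k q eps]wshift0; exact: cyclic_complex_equivalent.
by rewrite word_LE word_LyE; exact: cyclic_complex_equivalent.
Qed.
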